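(* Let $d\ge 2$, $p\ge 1$, let $C>0$ be admissible, and let $\mu,\nu\in\mathcal{P}_p(\mathbb{R}^d)$. Then: (a) $\mathrm{DSW}_p(\mu,\nu;C)\le \mathrm{maxSW}_p(\mu,\nu)\le W_p(\mu,\nu)$. (b) If $C\ge 1/d$, then $\mathrm{DSW}_p(\mu,\nu;C)\ge (1/d)^{1/p}\,\mathrm{maxSW}_p(\mu,\nu)\ge (1/d)^{1/p}\,\mathrm{SW}_p(\mu,\nu)$. As a consequence, when $p\ge1$ and $C\ge 1/d$, the metrics $\mathrm{DSW}_p(\cdot,\cdot;C)$, $\mathrm{SW}_p$, $\mathrm{maxSW}_p$ and $W_p$ are topologically equivalent on $\mathcal{P}_p(\mathbb{R}^d)$: for any sequence $(\mu_n)_{n\ge1}$ and $\mu$ in $\mathcal{P}_p(\mathbb{R}^d)$, convergence $\mu_n\to\mu$ under any one of these metrics implies convergence under each of the others.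
   Context: $\mathcal{P}_p(\mathbb{R}^d)$ is the set of Borel probability measures on $\mathbb{R}^d$ with finite $p$-th moment. $\mathbb{S}^{d-1}$ is the Euclidean unit sphere and $\sigma^{d-1}$ the uniform probability measure on it. For a probability measure $\mu$ on $\mathbb{R}^d$ and $\theta\in\mathbb{S}^{d-1}$, $\mathcal{R}\mu(\cdot,\theta)$ denotes the pushforward of $\mu$ under $x\mapsto\langle x,\theta\rangle$. $W_p$ is the Wasserstein distance of order $p$ with Euclidean ground cost. Define $\mathrm{SW}_p(\mu,\nu)=\big(\int_{\mathbb{S}^{d-1}}W_p^p(\mathcal{R}\mu(\cdot,\theta),\mathcal{R}\nu(\cdot,\theta))\,d\sigma^{d-1}(\theta)\big)^{1/p}$ and $\mathrm{maxSW}_p(\mu,\nu)=\max_{\theta\in\mathbb{S}^{d-1}}W_p(\mathcal{R}\mu(\cdot,\theta),\mathcal{R}\nu(\cdot,\theta))$. A constant $C>0$ is admissible if the set $\mathbb{M}_C$ of Borel probability measures $\sigma$ on $\mathbb{S}^{d-1}$ with $\mathbb{E}_{\theta,\theta'\sim\sigma}[|\theta^\top\theta'|]\le C$ ($\theta,\theta'$ independent) is nonempty, and then $\mathrm{DSW}_p(\mu,\nu;C)=\sup_{\sigma\in\mathbb{M}_C}\big(\mathbb{E}_{\theta\sim\sigma}[W_p^p(\mathcal{R}\mu(\cdot,\theta),\mathcal{R}\nu(\cdot,\theta))]\big)^{1/p}$. *)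

(* Defs.v *)
From HB Require Import structures.
From mathcomp Require Import all_boot all_order all_algebra.
From mathcomp Require Import all_classical all_reals all_analysis.
Set Implicit Arguments.
Unset Strict Implicit.
Unset Printing Implicit Defensive.
Import Order.TTheory GRing.Theory Num.Theory.
Local Open Scope classical_set_scope.
Local Open Scope ring_scope.

Section Defs.
Variable R : realType.

(* R^d is represented by d.-tuple R, equipped with mathcomp-analysis'  *)
(* product sigma-algebra of the Borel sets of R (= Borel sets of R^d). *)

Definition dotv (d : nat) (x y : d.-tuple R) : R :=
  \sum_(i < d) tnth x i * tnth y i.

Definition normv (d : nat) (x : d.-tuple R) : R := Num.sqrt (dotv x x).

Definition distv (d : nat) (x y : d.-tuple R) : R :=
  Num.sqrt (\sum_(i < d) (tnth x i - tnth y i) ^+ 2).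

Definition sphere (d : nat) : set (d.-tuple R) := [set x | normv x = 1].

(* Lebesgue measure on R^d (as an iterated Lebesgue integral, which   *)
(* equals the d-fold product Lebesgue measure by Tonelli) and the      *)
(* uniform probability measure sigma^{d-1} on the sphere, defined as   *)
(* the normalized cone measure:                                        *)
(*   sigma(A) = Leb{x : 0 < |x| <= 1, x/|x| in A} / Leb(unit ball),    *)
(* which is the normalized surface (Hausdorff) measure on S^{d-1}.     *)

Fixpoint iter_leb_int (n : nat) : (n.-tuple R -> \bar R) -> \bar R :=
  match n return (n.-tuple R -> \bar R) -> \bar R with
  | 0 => fun f => f [tuple]
  | n'.+1 => fun f =>
      (\int[@lebesgue_measure R]_(t in [set: R])
          iter_leb_int (fun x : n'.-tuple R => f (cons_tuple t x)))%E
  end.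

Definition lebesgue_vol (d : nat) (A : set (d.-tuple R)) : \bar R :=
  iter_leb_int (fun x => (\1_A x)%:E).

Definition normalize (d : nat) (x : d.-tuple R) : d.-tuple R :=
  map_tuple (fun xi => xi / normv x) x.

Definition unit_ball (d : nat) : set (d.-tuple R) := [set x | normv x <= 1].

Definition unif_sphere (d : nat) (A : set (d.-tuple R)) : \bar R :=
  (lebesgue_vol [set x | (0 < normv x <= 1)%R /\ A (normalize x)]
   * ((fine (lebesgue_vol (@unit_ball d)))^-1)%:E)%E.

Definition coupling d (T : measurableType d) (mu nu : set T -> \bar R)
    (pi : probability (T * T)%type R) : Prop :=
  forall A : set T, measurable A ->
    pi (A `*` [set: T]) = mu A /\ pi ([set: T] `*` A) = nu A.

Definition Wasserstein d (T : measurableType d) (c : T -> T -> R) (p : R)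
    (mu nu : set T -> \bar R) : \bar R :=
  ((ereal_inf [set v | exists pi : probability (T * T)%type R,
       coupling mu nu pi /\ v = \int[pi]_z ((c z.1 z.2) `^ p)%:E])
   `^ p^-1)%E.

Definition Wp (d : nat) (p : R) (mu nu : set (d.-tuple R) -> \bar R) : \bar R :=
  Wasserstein (@distv d) p mu nu.

Definition Wp1 (p : R) (mu nu : set R -> \bar R) : \bar R :=
  Wasserstein (fun x y : R => `|x - y|) p mu nu.

Definition finite_moment (d : nat) (p : R) (mu : set (d.-tuple R) -> \bar R) : Prop :=
  (\int[mu]_x ((normv x) `^ p)%:E < +oo)%E.

Definition radon (d : nat) (mu : set (d.-tuple R) -> \bar R) (th : d.-tuple R)
    : set R -> \bar R :=
  fun A => mu ((fun x => dotv x th) @^-1` A).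

Definition SW (d : nat) (p : R) (mu nu : set (d.-tuple R) -> \bar R) : \bar R :=
  ((\int[@unif_sphere d]_th ((Wp1 p (radon mu th) (radon nu th)) `^ p)) `^ p^-1)%E.

(* max-sliced Wasserstein (the max over the compact sphere is attained;
   we write it as the supremum) *)
Definition maxSW (d : nat) (p : R) (mu nu : set (d.-tuple R) -> \bar R) : \bar R :=
  ereal_sup [set Wp1 p (radon mu th) (radon nu th) | th in @sphere d].

(* M_C: Borel probability measures on S^{d-1} (represented as Borel
   probability measures on R^d giving full mass to S^{d-1}) with
   E_{theta,theta' ~ sigma iid} |theta^T theta'| <= C *)
Definition in_MC (d : nat) (C : R) (sg : probability (d.-tuple R) R) : Prop :=
  sg (@sphere d) = 1%E /\
  (\int[sg]_th \int[sg]_th' (`|dotv th th'|)%:E <= C%:E)%E.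

Definition admissible (d : nat) (C : R) : Prop :=
  0 < C /\ exists sg : probability (d.-tuple R) R, in_MC C sg.

Definition DSW (d : nat) (p : R) (mu nu : set (d.-tuple R) -> \bar R) (C : R)
    : \bar R :=
  ereal_sup [set v | exists sg : probability (d.-tuple R) R, in_MC C sg /\
     v = ((\int[sg]_th ((Wp1 p (radon mu th) (radon nu th)) `^ p)) `^ p^-1)%E].

Definition converges_under (d : nat)
    (D : (set (d.-tuple R) -> \bar R) -> (set (d.-tuple R) -> \bar R) -> \bar R)
    (mus : nat -> probability (d.-tuple R) R) (mu : probability (d.-tuple R) R)
    : Prop :=
  (fun n => D (mus n) mu) @ \oo --> (0 : \bar R).

End Defs.

(* Main.v *)
Require Import Defs.
From HB Require Import structures.
From mathcomp Require Import all_boot all_order all_algebra.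
From mathcomp Require Import all_classical all_reals all_analysis.
From mathcomp Require Import measurable_realfun ring lra.
Set Implicit Arguments.
Unset Strict Implicit.
Unset Printing Implicit Defensive.
Import Order.TTheory GRing.Theory Num.Theory.
Import numFieldNormedType.Exports.
Local Open Scope classical_set_scope.
Local Open Scope ring_scope.

(** The inequalities of (a) come from pushing couplings forward along
    projections, and (b) from testing DSW on the uniform measure over an
    orthonormal basis containing a given direction.

    The substance of the equivalence is that SW -> 0 forces Wp -> 0.  If
    SW(mu_n, mu) -> 0, then near every direction there are, for large n,
    directions whose slices have small Wasserstein cost.  Using them near the
    coordinate axes shows that p-th moments are uniformly integrable; together
    with the Lipschitz bounds this makes the characteristic functions converge
    at every point.  Hence integrals converge for products of Bernstein weights in
    the bounded coordinates (1 + sin (x_j / L)) / 2, which form a partition of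
    unity into cells that are small inside the ball of radius L.  Coupling mu_n
    and mu cell by cell gives a transport plan of small cost. *)

(** * Lower integrals *)

(** Two objects resist ordinary measure theory. The slice cost is an infimum over couplings, whose
    measurability in the direction is not established, and [unif_sphere] is a bare set function made
    of iterated integrals, not shown to be additive. Since the integral is a supremum over simple
    functions, it remains monotone and obeys Markov's inequality, and against a measure it is
    superadditive; these one-sided facts carry every estimate on [SW], and Markov's inequality the
    lower bound on [DSW]. Accordingly SW -> 0 is exploited only as follows: each cap contains, for
    large n, a good direction depending on n. Estimates along it must be moved to the wanted
    direction, at an error that grows with the size of the points; this is why tails are controlled
    before characteristic functions. Weak compactness is bypassed. Bernstein weights in sines are
    trigonometric polynomials, so cosine waves test them exactly, and a given precision involves
    finitely many weights. The final plan has an explicit density with respect to the product of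
    mu_n and mu. *)

Section RawIntegral.
Local Open Scope ereal_scope.
Context (R : realType) (d : measure_display) (T : measurableType d).
Implicit Types (s : set T -> \bar R) (f g : T -> \bar R).
Import HBNNSimple.

(** The negative part contributes nothing: the only nonnegative simple function below 0 is 0, and
    [s set0 = 0] kills the terms of the values it does not take. The formula holds for a bare set
    function and an arbitrary nonnegative integrand, hence for [unif_sphere] and for slice costs. *)
Lemma raw_integralE s f : s set0 = 0 -> (forall x, 0 <= f x) ->
  \int[s]_x f x = ereal_sup [set sintegral s h |
    h in [set h : {nnsfun T >-> R} | forall x, (h x)%:E <= f x]].
Proof.
move=> s0 f0; rewrite /integral patch_setT.
have -> : f^\+ = f by apply/funext => x; rewrite funeposE; apply/max_idPl.
have -> : f^\- = cst 0.
  by apply/funext => x; rewrite funenegE; apply/max_idPr; rewrite oppe_le0.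
set A := ereal_sup _; set B := ereal_sup _; suff -> : B = 0 by rewrite sube0.
have H (h : {nnsfun T >-> R}) : (forall x, (h x)%:E <= 0) -> sintegral s h = 0.
  move=> h0; have {}h0 : h = cst 0%R :> (T -> R).
    by apply/funext => x; apply/eqP; rewrite eq_le fun_ge0 -lee_fin h0.
  rewrite /sintegral; apply: fsbig1 => x _; rewrite h0.
  have [->|x0] := eqVneq x 0%R; first by rewrite mul0e.
  rewrite (_ : _ @^-1` _ = set0) ?s0 ?mule0// -subset0 => y /= xy.
  by rewrite -xy eqxx in x0.
apply/eqP; rewrite eq_le; apply/andP; split.
  by apply: ge_ereal_sup => _ [h hx <-]; rewrite H.
by apply: ereal_sup_ubound; exists (nnsfun0 : {nnsfun T >-> R}) => //; rewrite H.
Qed.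

Lemma le_raw_integral s f g : s set0 = 0 -> (forall x, 0 <= f x) ->
  (forall x, f x <= g x) -> \int[s]_x f x <= \int[s]_x g x.
Proof.
move=> s0 f0 fg; rewrite !raw_integralE//; last first.
  by move=> x; exact: le_trans (fg x).
apply: ereal_sup_le => _ [h hf <-]; exists h => //= x.
exact: le_trans (fg x).
Qed.

(** Markov's inequality: [c] times the indicator of [A] is a simple function below [f]. *)
Lemma raw_integral_ge s f (A : set T) (c : R) :
  s set0 = 0 -> (forall x, 0 <= f x) -> measurable A ->
  (0 <= c)%R -> (forall x, A x -> c%:E <= f x) -> c%:E * s A <= \int[s]_x f x.
Proof.
move=> s0 f0 mA c0 cf; rewrite raw_integralE//.
apply: ereal_sup_ubound; exists (scale_nnsfun (indic_nnsfun R mA) c0) => /=.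
  move=> x; rewrite /= mindicE.
  have [/set_mem Ax|_] := boolP (x \in A); first by rewrite mulr1 cf.
  by rewrite mulr0.
rewrite /sintegral -(fsbig_widen [set c] setT)//=; last first.
  move=> x [_ /= xc]; have [->|x0] := eqVneq x 0%R; first by rewrite mul0e.
  rewrite (_ : _ @^-1` _ = set0) ?s0 ?mule0// -subset0 => y /=.
  rewrite mindicE; case: (y \in A) => /=; rewrite ?mulr1 ?mulr0 => xy; first exact: xc.
  by rewrite -xy eqxx in x0.
rewrite fsbig_set1; have [->|cn0] := eqVneq c 0%R; first by rewrite !mul0e.
congr (_ * s _); apply/seteqP; split => y /=; rewrite mindicE.
  have [/set_mem//|_] := boolP (y \in A).
  by rewrite mulr0 => /esym/eqP; rewrite (negbTE cn0).
by move=> /mem_set ->; rewrite mulr1.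
Qed.

Lemma raw_integral_ge0 s f : s set0 = 0 -> (forall x, 0 <= f x) -> 0 <= \int[s]_x f x.
Proof.
move=> s0 f0; have := @raw_integral_ge s f set0 0%R s0 f0 measurable0 (lexx _).
by rewrite mul0e; apply.
Qed.

End RawIntegral.

Section SuperAdditive.
Local Open Scope ereal_scope.
Context (R : realType) (d : measure_display) (T : measurableType d).
Variable m : {measure set T -> \bar R}.
Implicit Types (f g : T -> \bar R).
Import HBNNSimple.

(** A sum of simple functions below [f] and [g] is a simple function below their sum. This half of
    additivity survives for integrands not known to be measurable, such as the inner integrals of
    [iter_leb_int]. *)
Lemma integralD_ge f g : (forall x, 0 <= f x) -> (forall x, 0 <= g x) ->
  \int[m]_x f x + \int[m]_x g x <= \int[m]_x (f x + g x).
Proof.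
move=> f0 g0; have fg0 x : 0 <= f x + g x by exact: adde_ge0.
have lef : \int[m]_x f x <= \int[m]_x (f x + g x).
  by apply: le_raw_integral => // x; rewrite leeDl.
have leg : \int[m]_x g x <= \int[m]_x (f x + g x).
  by apply: le_raw_integral => // x; rewrite leeDr.
have [fgoo|] := eqVneq (\int[m]_x (f x + g x)) +oo; first by rewrite fgoo leey.
rewrite -ltey => fgoo.
have If : \int[m]_x f x \is a fin_num.
  by rewrite ge0_fin_numE ?integral_ge0//; exact: le_lt_trans fgoo.
have Ig : \int[m]_x g x \is a fin_num.
  by rewrite ge0_fin_numE ?integral_ge0//; exact: le_lt_trans fgoo.
rewrite -leeBrDr// [leLHS]raw_integralE//.
apply: ge_ereal_sup => _ [h hf <-]; rewrite leeBrDr//.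
have hfin : sintegral m h \is a fin_num.
  rewrite ge0_fin_numE ?sintegral_ge0//; apply: le_lt_trans fgoo.
  apply: le_trans lef; rewrite raw_integralE//.
  by apply: ereal_sup_ubound; exists h.
rewrite addeC -leeBrDr// [leLHS]raw_integralE//.
apply: ge_ereal_sup => _ [k kg <-]; rewrite leeBrDr// addeC -sintegralD//.
rewrite [leRHS]raw_integralE//; apply: ereal_sup_ubound.
by exists (add_nnsfun h k) => // x /=; rewrite EFinD leeD.
Qed.

End SuperAdditive.

(** * Euclidean geometry *)

Section Euclid.
Context {R : realType} {d : nat}.
Implicit Types x y z : d.-tuple R.

Lemma dotvC x y : dotv x y = dotv y x.
Proof. by apply: eq_bigr => i _; rewrite mulrC. Qed.

Lemma dotvv_ge0 x : 0 <= dotv x x.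
Proof. by apply: sumr_ge0 => i _; rewrite -expr2 sqr_ge0. Qed.

Lemma normv_ge0 x : 0 <= normv x.
Proof. exact: sqrtr_ge0. Qed.

Lemma sqr_normv x : normv x ^+ 2 = dotv x x.
Proof. by rewrite sqr_sqrtr// dotvv_ge0. Qed.

Lemma distv_ge0 x y : 0 <= distv x y.
Proof. exact: sqrtr_ge0. Qed.

Lemma distvE x y : distv x y = normv [tuple tnth x i - tnth y i | i < d].
Proof.
by congr Num.sqrt; apply: eq_bigr => i _; rewrite !tnth_mktuple expr2.
Qed.

(** Cauchy-Schwarz: the squared norm of (y.y) x - (x.y) y equals (y.y) ((x.x)(y.y) - (x.y)^2). *)
Lemma dotv_sqr_le x y : dotv x y ^+ 2 <= dotv x x * dotv y y.
Proof.
have [N0|N0] := eqVneq (dotv y y) 0.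
  suff -> : dotv x y = 0 by rewrite expr0n N0 mulr0.
  apply: big1 => i _; have : tnth y i * tnth y i = 0.
    apply/eqP; have /eqP := N0; rewrite /dotv psumr_eq0.
      by move=> /allP/(_ i)/(_ (mem_index_enum _)).
    by move=> j _; rewrite -expr2 sqr_ge0.
  by move=> /eqP; rewrite mulf_eq0 orbb => /eqP ->; rewrite mulr0.
have Ngt0 : 0 < dotv y y by rewrite lt_def N0 dotvv_ge0.
have : 0 <= \sum_(i < d) (dotv y y * tnth x i - dotv x y * tnth y i) ^+ 2.
  by apply: sumr_ge0 => i _; rewrite sqr_ge0.
rewrite (eq_bigr (fun i => dotv y y ^+ 2 * (tnth x i * tnth x i)
   - (2 * dotv y y * dotv x y) * (tnth x i * tnth y i)
   + dotv x y ^+ 2 * (tnth y i * tnth y i))); last by move=> i _; ring.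
rewrite big_split/= sumrB -!mulr_sumr -/(dotv x x) -/(dotv x y) -/(dotv y y).
move=> H; rewrite -(ler_pM2l Ngt0) -subr_ge0; apply: le_trans H _.
by rewrite le_eqVlt; apply/orP; left; apply/eqP; ring.
Qed.

Lemma normr_dotv_le x y : `|dotv x y| <= normv x * normv y.
Proof.
rewrite -[leLHS](@sqrtr_sqr R) -sqrtrM ?dotvv_ge0// ler_sqrt ?dotv_sqr_le//.
by rewrite mulr_ge0 ?dotvv_ge0.
Qed.

Lemma normv_triangle x y z : (forall i, tnth x i = tnth y i + tnth z i) ->
  normv x <= normv y + normv z.
Proof.
move=> xyz; rewrite -(@ler_pXn2r R 2)// ?nnegrE ?normv_ge0// ?addr_ge0 ?normv_ge0//.
rewrite sqrrD !sqr_normv.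
have -> : dotv x x = dotv y y + dotv y z *+ 2 + dotv z z.
  rewrite /dotv -sumrMnl -!big_split/=; apply: eq_bigr => i _.
  by rewrite xyz; ring.
rewrite lerD2r lerD2l lerMn2r/=; apply: le_trans (ler_norm _) _.
exact: normr_dotv_le.
Qed.

Lemma normv_coord x i : `|tnth x i| <= normv x.
Proof.
rewrite -[leLHS](@sqrtr_sqr R) ler_sqrt ?dotvv_ge0// /dotv (bigD1 i)//= expr2.
by rewrite lerDl sumr_ge0// => j _; rewrite -expr2 sqr_ge0.
Qed.

Lemma normv_le_sum x : normv x <= \sum_(i < d) `|tnth x i|.
Proof.
rewrite -(@ler_pXn2r R 2)// ?nnegrE ?normv_ge0// ?sumr_ge0//.
rewrite sqr_normv expr2 mulr_suml; apply: ler_sum => i _.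
apply: le_trans (ler_norm _) _; rewrite normrM ler_wpM2l//.
by rewrite (bigD1 i)//= lerDl sumr_ge0.
Qed.

Lemma normv_le_const x c : (forall i, `|tnth x i| <= c) -> normv x <= d%:R * c.
Proof.
move=> xc; apply: le_trans (normv_le_sum x) _.
apply: le_trans (ler_sum (G := fun=> c) _ _) _; first by move=> i _; exact: xc.
by rewrite sumr_const card_ord mulr_natl.
Qed.

Lemma normv_le_dist x y : normv x <= normv y + distv x y.
Proof.
rewrite distvE; apply: normv_triangle => i; rewrite tnth_mktuple; ring.
Qed.

Lemma distvC x y : distv x y = distv y x.
Proof. by congr Num.sqrt; apply: eq_bigr => i _; rewrite -sqrrN opprB. Qed.

Lemma distv_le x y : distv x y <= normv x + normv y.
Proof.
have -> : normv y = normv [tuple - tnth y i | i < d].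
  by congr Num.sqrt; apply: eq_bigr => i _; rewrite !tnth_mktuple mulrNN.
by rewrite distvE; apply: normv_triangle => i; rewrite !tnth_mktuple.
Qed.

Lemma dotvB_le x y z : `|dotv x z - dotv y z| <= distv x y * normv z.
Proof.
have -> : dotv x z - dotv y z = dotv [tuple tnth x i - tnth y i | i < d] z.
  by rewrite /dotv -sumrB; apply: eq_bigr => i _; rewrite tnth_mktuple mulrBl.
by rewrite distvE normr_dotv_le.
Qed.

Lemma normv_normalize x : 0 < normv x -> normv (normalize x) = 1.
Proof.
move=> x0; have x0' := lt0r_neq0 x0.
rewrite /normv /dotv (eq_bigr (fun i => (tnth x i * tnth x i) / normv x ^+ 2)); last first.
  by move=> i _; rewrite /normalize !tnth_map; field.
by rewrite -mulr_suml -/(dotv x x) -sqr_normv divff ?expf_neq0// sqrtr1.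
Qed.

Lemma measurable_dotv (f g : d.-tuple R -> d.-tuple R) :
  measurable_fun setT f -> measurable_fun setT g ->
  measurable_fun setT (fun x => dotv (f x) (g x)).
Proof.
move=> mf mg; apply: measurable_sum => i.
by apply: measurable_funM; apply: (measurableT_comp (measurable_tnth i)).
Qed.

Lemma measurable_sqrt : measurable_fun setT (@Num.sqrt R).
Proof. by apply: continuous_measurable_fun; exact: sqrt_continuous. Qed.

Lemma measurable_dotvl y : measurable_fun setT (fun x => dotv x y).
Proof. by apply: measurable_dotv => //; exact: measurable_cst. Qed.

Lemma measurable_normv : measurable_fun setT (@normv R d).
Proof. by apply: (measurableT_comp measurable_sqrt); exact: measurable_dotv. Qed.

Lemma measurable_distvl y : measurable_fun setT (fun x => distv x y).
Proof.
apply: (measurableT_comp measurable_sqrt); apply: measurable_sum => i.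
by apply: measurable_funX; apply: measurable_funB => //; exact: measurable_tnth.
Qed.

Lemma measurable_sphere : measurable (@sphere R d).
Proof.
rewrite (_ : @sphere R d = @normv R d @^-1` [set 1])//.
by rewrite -[X in measurable X]setTI; exact: measurable_normv.
Qed.

End Euclid.

(** * The uniform measure on the sphere *)

Section IteratedLebesgue.
Local Open Scope ereal_scope.
Context {R : realType}.
Import HBNNSimple.

Lemma iter_leb_ge0 n (f : n.-tuple R -> \bar R) :
  (forall x, 0 <= f x) -> 0 <= iter_leb_int f.
Proof.
elim: n f => [|n IH] f f0 /=; first exact: f0.
by apply: integral_ge0 => t _; exact: IH.
Qed.

Lemma iter_leb_le n (f g : n.-tuple R -> \bar R) :
  (forall x, 0 <= f x) -> (forall x, f x <= g x) ->
  iter_leb_int f <= iter_leb_int g.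
Proof.
elim: n f g => [|n IH] f g f0 fg /=; first exact: fg.
apply: le_raw_integral => // t; first exact: iter_leb_ge0.
by apply: IH.
Qed.

Lemma iter_lebD_ge n (f g : n.-tuple R -> \bar R) :
  (forall x, 0 <= f x) -> (forall x, 0 <= g x) ->
  iter_leb_int f + iter_leb_int g <= iter_leb_int (fun x => f x + g x).
Proof.
elim: n f g => [|n IH] f g f0 g0 //=.
apply: (le_trans (integralD_ge _ _ _)) => [t|t|].
- exact: iter_leb_ge0.
- exact: iter_leb_ge0.
apply: le_raw_integral => // t; last exact: IH.
by rewrite adde_ge0// iter_leb_ge0.
Qed.

Lemma iter_leb0 n : iter_leb_int (fun _ : n.-tuple R => 0) = 0.
Proof.
by elim: n => [|n IH] //=; apply: integral0_eq => t _; exact: IH.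
Qed.

Lemma iter_leb_sum_ge n (I : Type) (r : seq I) (f : I -> n.-tuple R -> \bar R) :
  (forall i x, 0 <= f i x) ->
  \sum_(i <- r) iter_leb_int (f i) <= iter_leb_int (fun x => \sum_(i <- r) f i x).
Proof.
move=> f0; elim: r => [|i r IH].
  rewrite big_nil; apply: iter_leb_ge0 => x; by rewrite big_nil.
rewrite big_cons; apply: le_trans (leeD2l _ IH) _.
apply: (le_trans (iter_lebD_ge _ _)) => // [x|].
  by apply: sume_ge0.
apply: iter_leb_le => x; last by rewrite big_cons.
by rewrite adde_ge0// sume_ge0.
Qed.

(** The centre is indexed by [nat] so that an induction on the dimension can drop its first
    coordinate as [a \o S]. *)
Definition cube n (a : nat -> R) (s : R) : set (n.-tuple R) :=
  [set x | forall i : 'I_n, (`|tnth x i - a i| <= s)%R].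

Lemma lebesgue_vol_cube n (a : nat -> R) (s : R) : (0 <= s)%R ->
  lebesgue_vol (@cube n a s) = ((s *+ 2) ^+ n)%:E.
Proof.
move=> s0; rewrite /lebesgue_vol; elim: n a => [|n IH] a.
  by rewrite /= indicE mem_set//= => -[].
have cubeS t (x : n.-tuple R) : (\1_(@cube n.+1 a s) (cons_tuple t x))%:E =
    (\1_`[(a 0%N - s)%R, (a 0%N + s)%R] t)%:E * (\1_(@cube n (a \o S) s) x)%:E :> \bar R.
  rewrite -EFinM !indicE -natrM mulnb; congr (_%:R%:E); congr nat_of_bool.
  apply/idP/andP.
    move=> /set_mem H; split; apply/mem_set => /=.
      by have := H ord0; rewrite tnth0 in_itv/= ler_distl.
    by move=> i; have := H (lift ord0 i); rewrite tnthS.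
  move=> [/set_mem/= H1 /set_mem/= H2]; apply/mem_set => i.
  case: (unliftP ord0 i) => [j ->|->]; first by rewrite tnthS; exact: H2.
  by rewrite tnth0; move: H1; rewrite in_itv/= ler_distl.
rewrite [LHS]/=.
transitivity (\int[@lebesgue_measure R]_t (((s *+ 2) ^+ n)%:E *
    (\1_`[(a 0%N - s)%R, (a 0%N + s)%R] t)%:E)).
  apply: eq_integral => t _.
  rewrite -(IH (a \o S)); under [X in iter_leb_int X]eq_fun do rewrite cubeS.
  rewrite indicE; case: (_ \in _) => /=.
    by rewrite mule1; congr iter_leb_int; apply/funext => x; rewrite mul1e.
  by rewrite mule0 -(iter_leb0 n); congr iter_leb_int; apply/funext => x; rewrite mul0e.
rewrite ge0_integralZl_EFin//; last 2 first.
- by apply/measurable_EFinP; exact: measurable_indic.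
- by rewrite exprn_ge0// mulrn_wge0.
rewrite integral_indic// setIT /= lebesgue_measure_itv/= lte_fin.
rewrite exprS mulrC.
case: ifPn => [_|]; first by rewrite -EFinB -EFinM; congr (_ * _)%:E; lra.
rewrite -leNgt => h; have -> : s = 0%R by lra.
by rewrite mul0rn mule0 mulr0.
Qed.

Lemma lebesgue_vol_ge0 n (A : set (n.-tuple R)) : 0 <= lebesgue_vol A.
Proof. by apply: iter_leb_ge0 => x; rewrite lee_fin. Qed.

Lemma le_lebesgue_vol n (A B : set (n.-tuple R)) : A `<=` B ->
  lebesgue_vol A <= lebesgue_vol B.
Proof.
move=> AB; apply: iter_leb_le => x; rewrite lee_fin// !indicE ler_nat.
by have [/set_mem/AB/mem_set ->|] := boolP (x \in A).
Qed.

Lemma lebesgue_vol0 n : lebesgue_vol (@set0 (n.-tuple R)) = 0.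
Proof.
rewrite -(iter_leb0 n) /lebesgue_vol; congr iter_leb_int.
by apply/funext => x; rewrite indic0.
Qed.

Lemma lebesgue_vol_ball_lty n : lebesgue_vol (@unit_ball R n) < +oo.
Proof.
have : lebesgue_vol (@unit_ball R n) <= lebesgue_vol (@cube n (fun=> 0%R) 1).
  apply: le_lebesgue_vol => x /= x1 i; rewrite subr0.
  exact: le_trans (normv_coord x i) x1.
by move=> /le_lt_trans; apply; rewrite lebesgue_vol_cube// ltry.
Qed.

Lemma unif_sphere0 n : @unif_sphere R n set0 = 0.
Proof.
rewrite /unif_sphere (_ : [set x | _] = set0) ?lebesgue_vol0 ?mul0e//.
by rewrite -subset0 => x [].
Qed.

Lemma unif_sphere_ge0 n (A : set (n.-tuple R)) : 0 <= unif_sphere A.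
Proof.
rewrite /unif_sphere mule_ge0 ?lebesgue_vol_ge0// lee_fin invr_ge0 fine_ge0//.
exact: lebesgue_vol_ge0.
Qed.

(** A small cube centred at [th0] / 2 stays inside the unit ball and away from 0, and normalizes
    into the cap. *)
Lemma lebesgue_vol_cap n (th0 : n.-tuple R) (r : R) :
  (0 < n)%N -> normv th0 = 1%R -> (0 < r)%R ->
  0 < lebesgue_vol [set x : n.-tuple R | (0 < normv x <= 1)%R /\
        (sphere (normalize x) /\ (distv (normalize x) th0 < r)%R)].
Proof.
move=> n0 th01 r0.
have N0 : (0 < n%:R :> R)%R by rewrite ltr0n.
have N1 : (1 <= n%:R :> R)%R by rewrite ler1n.
pose N : R := n%:R.
have {N0 N1} : (0 < N)%R /\ (1 <= N)%R by [].
have NE : N = (n%:R)%R by [].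
clearbody N; move=> [N0 N1].
(* Points of the cube are within N s <= 1/8 of [th0] / 2, so their norm is at least 3/8 and each
   normalized coordinate is off by at most 4 (s + N s). Summed over N coordinates, this is 4 N (1 +
   N) s <= r / 2. *)
pose s : R := (Num.min 1 r / (8 * N * (1 + N)))%R.
have D0 : (0 < 8 * N * (1 + N))%R by rewrite !mulr_gt0// addr_gt0.
have s0 : (0 < s)%R by rewrite divr_gt0// lt_min ltr01.
have sD : (s * (8 * N * (1 + N)) = Num.min 1 r)%R by rewrite /s divfK// gt_eqF.
have sD1 : (s * (8 * N * (1 + N)) <= 1)%R by rewrite sD ge_min lexx.
have sDr : (s * (8 * N * (1 + N)) <= r)%R by rewrite sD ge_min lexx orbT.
clearbody s; have Ns0 : (0 < N * s)%R by rewrite mulr_gt0.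
have Ns : (N * s <= 1 / 8)%R.
  have : (0 <= s * N * N)%R by rewrite !mulr_ge0//; exact: ltW.
  nra.
pose a (i : nat) : R := if insub i is Some j then (tnth th0 j / 2)%R else 0%R.
have aE (i : 'I_n) : a i = (tnth th0 i / 2)%R by rewrite /a valK.
apply: (@lt_le_trans _ _ (lebesgue_vol (@cube n a s))).
  by rewrite lebesgue_vol_cube ?ltW// lte_fin exprn_gt0// mulrn_wgt0.
apply: le_lebesgue_vol => x xs.
have {}xs i : (`|tnth x i - tnth th0 i / 2| <= s)%R by rewrite -aE; exact: xs.
pose h : n.-tuple R := [tuple (tnth th0 i / 2)%R | i < n].
have normh : (normv h = 1 / 2)%R.
  have -> : (1 / 2 : R)%R = Num.sqrt ((1 / 2) ^+ 2 * normv th0 ^+ 2)%R.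
    by rewrite th01 expr1n mulr1 sqrtr_sqr ger0_norm// divr_ge0.
  rewrite sqr_normv /normv /dotv mulr_sumr; congr Num.sqrt.
  by apply: eq_bigr => i _; rewrite !tnth_mktuple; field.
have xh : (distv x h <= N * s)%R.
  by rewrite distvE NE; apply: normv_le_const => i; rewrite !tnth_mktuple.
have xle := normv_le_dist x h; have xge := normv_le_dist h x.
rewrite distvC in xge.
have x0 : (0 < normv x)%R by lra.
split; first by rewrite x0; lra.
split; first exact: normv_normalize.
rewrite distvE; apply: (@le_lt_trans _ _ (N * (4 * (s + N * s)))%R); last first.
  have : (0 < s * N * N)%R by rewrite !mulr_gt0.
  have : (0 < s * N)%R by rewrite !mulr_gt0.
  nra.
rewrite NE; apply: normv_le_const => i; rewrite -NE !tnth_mktuple /normalize tnth_map.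
have -> : (tnth x i / normv x - tnth th0 i =
   (tnth x i - normv x * tnth th0 i) / normv x)%R by field; rewrite gt_eqF.
rewrite normrM normfV (gtr0_norm x0) ler_pdivrMr//.
have H1 : (`|tnth x i - normv x * tnth th0 i| <= s + N * s)%R.
  have -> : (tnth x i - normv x * tnth th0 i =
    (tnth x i - tnth th0 i / 2) + (1 / 2 - normv x) * tnth th0 i)%R by ring.
  apply: le_trans (ler_normD _ _) _; apply: lerD => //.
  rewrite normrM -[leRHS]mulr1; apply: ler_pM => //.
    by rewrite ler_norml; apply/andP; split; lra.
  by rewrite -th01 normv_coord.
apply: le_trans H1 _.
have : (0 < s + N * s)%R by rewrite addr_gt0.
nra.
Qed.

Lemma unif_sphere_cap n (th0 : n.-tuple R) (r : R) :
  (0 < n)%N -> normv th0 = 1%R -> (0 < r)%R ->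
  0 < unif_sphere [set th | @sphere R n th /\ (distv th th0 < r)%R].
Proof.
move=> n0 th01 r0; have := lebesgue_vol_cap n0 th01 r0.
move=> V0; rewrite /unif_sphere mule_gt0// lte_fin invr_gt0 fine_gt0//.
rewrite lebesgue_vol_ball_lty andbT; apply: lt_le_trans V0 _.
by apply: le_lebesgue_vol => x [/andP[_ ?] _].
Qed.

(** The level sets of a simple function span disjoint cones in the unit ball, so superadditivity of
    the iterated integral already bounds their total volume by that of the ball. *)
Lemma unif_sphere_integral_le n (f : n.-tuple R -> \bar R) (M : R) :
  (forall x, 0 <= f x) -> (forall x, sphere x -> f x <= M%:E) -> (0 <= M)%R ->
  \int[@unif_sphere R n]_x f x <= M%:E.
Proof.
move=> f0 fM M0; rewrite raw_integralE//; last exact: unif_sphere0.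
apply: ge_ereal_sup => _ [h /= hf <-].
have hM x : sphere x -> (h x <= M)%R.
  by move=> /fM fxM; rewrite -lee_fin; exact: le_trans fxM.
rewrite /sintegral -(fsbig_widen (range h) setT)//=; last first.
  move=> x [_ Nfx] /=.
  by rewrite preimage10// unif_sphere0 mule0.
rewrite fsbig_finite//=; set r := finmap.enum_fset _.
have ur : uniq r by exact: finmap.fset_uniq.
apply: (@le_trans _ _ (\sum_(x <- r) M%:E * unif_sphere (h @^-1` [set x]))).
  (* Values above [M] are taken off the sphere only, and [unif_sphere] sees a set only through
     normalized points. *)
  apply: lee_sum => x _; have [xM|Mx] := leP x M.
    by apply: lee_wpmul2r; rewrite ?lee_fin// unif_sphere_ge0.
  rewrite (_ : unif_sphere _ = 0) ?mule0// /unif_sphere.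
  rewrite (_ : [set x | _] = set0) ?lebesgue_vol0 ?mul0e// -subset0.
  move=> y [/andP[y0 _]] /= hx.
  by have := hM _ (normv_normalize y0); rewrite hx leNgt Mx.
rewrite -ge0_sume_distrr; last by move=> x _; exact: unif_sphere_ge0.
rewrite -[leRHS]mule1; apply: lee_wpmul2l; first by rewrite lee_fin.
rewrite /unif_sphere -ge0_sume_distrl; last by move=> x _; exact: lebesgue_vol_ge0.
apply: (@le_trans _ _ (lebesgue_vol (@unit_ball R n) *
    ((fine (lebesgue_vol (@unit_ball R n)))^-1)%:E)).
  apply: lee_wpmul2r.
    by rewrite lee_fin invr_ge0 fine_ge0// lebesgue_vol_ge0.
  apply: (le_trans (iter_leb_sum_ge _ _)) => //.
  apply: iter_leb_le => y; first by apply: sume_ge0.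
  rewrite sumEFin lee_fin indicE.
  have [/set_mem yB|yB] := boolP (y \in @unit_ball R n); last first.
    apply/sumr_le0 => x _; rewrite indicE memNset// => -[/andP[_ ?] _].
    by move/negP: yB; apply; exact/mem_set.
  apply: (@le_trans _ _ (\sum_(x <- r) (x == h (normalize y))%:R)%R).
    apply: ler_sum => x _; rewrite indicE ler_nat.
    have [/set_mem [_ /= ->]|] := boolP (y \in _); last by [].
    by rewrite eqxx.
  rewrite -natr_sum ler_nat.
  rewrite (eq_bigr (fun x => if x == h (normalize y) then 1%N else 0%N)); last first.
    by move=> x _; case: (_ == _).
  by rewrite -big_mkcond/= sum1_count count_uniq_mem//; case: (_ \in _).
have := lebesgue_vol_ball_lty n; have := lebesgue_vol_ge0 (@unit_ball R n).
case: (lebesgue_vol _) => [v v0 _|//|//] /=; rewrite -EFinM lee_fin.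
by have [->|v1] := eqVneq v 0%R; rewrite ?mul0r// divff.
Qed.

End IteratedLebesgue.

(** * Couplings and Wasserstein costs *)

Section MassOne.
Local Open Scope ereal_scope.
Context d (T : measurableType d) (R : realType) (m : {measure set T -> \bar R}).
Hypothesis m1 : m [set: T] = 1.

(** An alias of [m] that carries the proof of total mass one, so that a [probability] structure can
    be attached to it. *)
Definition mass_one of m [set: T] = 1 : set T -> \bar R := m.

HB.instance Definition _ := Measure.copy (mass_one m1) m.
HB.instance Definition _ := Measure_isProbability.Build _ _ _ (mass_one m1) m1.

Lemma measure_probability : exists P : probability T R, forall A, P A = m A.
Proof. by exists (mass_one m1). Qed.

End MassOne.

Section Measures.
Local Open Scope ereal_scope.
Context (R : realType).

Lemma image_probability d1 d2 (T1 : measurableType d1) (T2 : measurableType d2)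
    (P : probability T1 R) (f : T1 -> T2) : measurable_fun setT f ->
  exists Q : probability T2 R, (forall A, Q A = P (f @^-1` A)) /\
    forall F : T2 -> \bar R, measurable_fun setT F -> (forall x, 0 <= F x) ->
      \int[Q]_y F y = \int[P]_x F (f x).
Proof.
move=> mf.
pose mfm := isMeasurableFun.Build _ _ _ _ _ mf.
pose X : {mfun T1 >-> T2} := HB.pack f mfm.
exists (distribution P X); split => // F mF F0.
by rewrite ge0_integral_distribution.
Qed.

Lemma integral_image d1 d2 (T1 : measurableType d1) (T2 : measurableType d2)
    (P : probability T1 R) (Q : {measure set T2 -> \bar R}) (f : T1 -> T2) (F : T2 -> \bar R) :
  measurable_fun setT f -> (forall A, measurable A -> Q A = P (f @^-1` A)) ->
  measurable_fun setT F -> (forall x, 0 <= F x) ->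
  \int[Q]_y F y = \int[P]_x F (f x).
Proof.
move=> mf QP mF F0.
have [Q' [Q'P <-//]] := image_probability P mf.
by apply: eq_measure_integral => A mA _; exact: etrans (QP _ mA) (esym (Q'P A)).
Qed.

(* [f] carries [P] to the marginals of [pi]: it is the identity for a coupling
   of measures on [R^d], and a projection for a coupling of slices. *)
Lemma coupling_integral d1 d2 (T1 : measurableType d1) (T2 : measurableType d2)
    (P P' : probability T1 R) (f : T1 -> T2) (pi : probability (T2 * T2)%type R)
    (F : T2 -> \bar R) :
  measurable_fun setT f ->
  coupling (fun A => P (f @^-1` A)) (fun A => P' (f @^-1` A)) pi ->
  measurable_fun setT F -> (forall x, 0 <= F x) ->
  \int[pi]_z F z.1 = \int[P]_x F (f x) /\ \int[pi]_z F z.2 = \int[P']_x F (f x).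
Proof.
move=> mf cpl mF F0.
have [Q [QP QI]] := image_probability P mf.
have [Q' [QP' QI']] := image_probability P' mf.
rewrite -QI// -QI'//; split; apply/esym/integral_image => //.
- move=> A mA; apply: (etrans (QP A)); rewrite -(cpl A mA).1; congr (pi _); apply/seteqP; by split => [[x y] []|[x y]].
- move=> A mA; apply: (etrans (QP' A)); rewrite -(cpl A mA).2; congr (pi _); apply/seteqP; by split => [[x y] []|[x y]].
Qed.

End Measures.

Section WassersteinBasics.
Local Open Scope ereal_scope.
Context (R : realType) (p : R) (p1 : (1 <= p)%R).

Let p_gt0 : (0 < p)%R. Proof. exact: lt_le_trans p1. Qed.
Let p_neq0 : p != 0%R. Proof. exact: lt0r_neq0. Qed.

Lemma Wasserstein_ge0 d (T : measurableType d) (c : T -> T -> R) mu nu :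
  0 <= Wasserstein c p mu nu.
Proof. exact: poweR_ge0. Qed.

Lemma poweRVK (x : \bar R) : 0 <= x -> (x `^ p^-1) `^ p = x.
Proof. by move=> x0; rewrite -poweRrM mulVf// poweRe1. Qed.

Lemma poweRKV (x : \bar R) : 0 <= x -> (x `^ p) `^ p^-1 = x.
Proof. by move=> x0; rewrite -poweRrM mulfV// poweRe1. Qed.

Lemma le_poweR (x y : \bar R) (q : R) : (0 <= q)%R -> 0 <= x -> x <= y -> x `^ q <= y `^ q.
Proof.
move=> q0 x0 xy; apply: gt0_ler_poweR => //; rewrite in_itv/= leey andbT//.
exact: le_trans xy.
Qed.

Lemma poweR_le (x y : \bar R) : 0 <= x -> 0 <= y -> x `^ p <= y `^ p -> x <= y.
Proof.
move=> x0 y0 /(@le_poweR _ _ p^-1); rewrite !poweRKV//; apply.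
  by rewrite invr_ge0 ltW.
exact: poweR_ge0.
Qed.

Lemma WassersteinX d (T : measurableType d) (c : T -> T -> R) mu nu :
  Wasserstein c p mu nu `^ p = ereal_inf [set v | exists pi : probability (T * T)%type R,
       coupling mu nu pi /\ v = \int[pi]_z ((c z.1 z.2) `^ p)%:E].
Proof.
rewrite poweRVK//; apply: le_ereal_inf_tmp => _ [pi [_ ->]].
by apply: integral_ge0 => z _; rewrite lee_fin powR_ge0.
Qed.

Lemma le_Wasserstein d (T : measurableType d) (c : T -> T -> R) mu nu pi :
  coupling mu nu pi ->
  Wasserstein c p mu nu `^ p <= \int[pi]_z ((c z.1 z.2) `^ p)%:E.
Proof. by move=> ?; rewrite WassersteinX; apply: ereal_inf_lbound; exists pi. Qed.

Lemma Wasserstein_lt d (T : measurableType d) (c : T -> T -> R) mu nu (r : \bar R) :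
  Wasserstein c p mu nu `^ p < r ->
  exists pi, coupling mu nu pi /\ \int[pi]_z ((c z.1 z.2) `^ p)%:E < r.
Proof.
by rewrite WassersteinX => /ereal_inf_lt[_ [pi [? ->]] ?]; exists pi.
Qed.

Lemma Wp1_le_Wp n (mu nu : probability (n.-tuple R) R) th : normv th = 1%R ->
  Wp1 p (radon mu th) (radon nu th) <= Wp p mu nu.
Proof.
move=> th1; apply: poweR_le; rewrite /Wp1 /Wp; [exact: Wasserstein_ge0|exact: Wasserstein_ge0|].
rewrite [leRHS]WassersteinX; apply: le_ereal_inf_tmp => _ [pi [cpl ->]].
pose f (z : n.-tuple R * n.-tuple R) := (dotv z.1 th, dotv z.2 th).
have mf : measurable_fun setT f.
  apply: measurable_fun_pair.
    exact: (measurableT_comp (measurable_dotvl th) measurable_fst).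
  exact: (measurableT_comp (measurable_dotvl th) measurable_snd).
have [Q [QP QI]] := image_probability pi mf.
have cplQ : coupling (radon mu th) (radon nu th) Q.
  move=> A mA; rewrite !QP /radon.
  have mA' : measurable ((fun x : n.-tuple R => dotv x th) @^-1` A).
    by rewrite -[X in measurable X]setTI; exact: measurable_dotvl.
  by rewrite -(cpl _ mA').1 -(cpl _ mA').2; split; congr (pi _);
    apply/seteqP; split => -[x y] [].
apply: le_trans (le_Wasserstein _ cplQ) _; rewrite QI; last 2 first.
- apply/measurable_EFinP; apply: (measurableT_comp (measurable_powR p)).
  apply: measurableT_comp => //; exact: measurable_funB.
- by move=> z; rewrite lee_fin powR_ge0.
apply: le_raw_integral => [|z|z]; rewrite ?measure0// ?lee_fin ?powR_ge0//.
rewrite ge0_ler_powR ?nnegrE ?distv_ge0 ?(ltW p_gt0)//=.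
by rewrite -[leRHS]mulr1 -th1 dotvB_le.
Qed.

End WassersteinBasics.

(** * Comparison of the distances *)

Section Householder.
Context (R : realType) (d : nat).
Implicit Types (v th : d.-tuple R) (k : 'I_d).

Lemma dotvv_eq0 v i : dotv v v = 0 -> tnth v i = 0.
Proof.
move=> /eqP; rewrite /dotv psumr_eq0; last by move=> j _; rewrite -expr2 sqr_ge0.
by move=> /allP/(_ i (mem_index_enum _)); rewrite mulf_eq0 orbb => /eqP.
Qed.

Lemma distv_eq0 v th : distv v th = 0 -> v = th.
Proof.
rewrite distvE => vth; apply: eq_from_tnth => i; apply/eqP; rewrite -subr_eq0.
have := @dotvv_eq0 [tuple tnth v i - tnth th i | i < d] i.
by rewrite tnth_mktuple -sqr_normv vth expr0n => /(_ erefl) ->.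
Qed.

(* Rows of the reflection swapping [th] and the [k]-th basis vector;
   for [th = e_k] the junk value [2 / 0 = 0] gives the standard basis. *)
Definition reflection_row th k (i : 'I_d) : d.-tuple R :=
  let v := [tuple tnth th j - (j == k)%:R | j < d] in
  [tuple (i == j)%:R - 2 / dotv v v * tnth v i * tnth v j | j < d].

(** The matrix is 1 - c v v^T with c = 2 / |v|^2; in its square the cross terms -2c and the term c^2
    |v|^2 cancel. *)
Lemma dotv_reflection th k i j :
  dotv (reflection_row th k i) (reflection_row th k j) = (i == j)%:R.
Proof.
rewrite /reflection_row /=; set v := mktuple (fun j : 'I_d => tnth th j - (j == k)%:R); set c := 2 / _.
have -> : dotv [tuple (i == l)%:R - c * tnth v i * tnth v l | l < d]
    [tuple (j == l)%:R - c * tnth v j * tnth v l | l < d] =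
    \sum_(l < d) (i == l)%:R * (j == l)%:R
    - c * tnth v j * (\sum_(l < d) (i == l)%:R * tnth v l)
    - c * tnth v i * (\sum_(l < d) (j == l)%:R * tnth v l)
    + c * tnth v i * (c * tnth v j) * dotv v v.
  rewrite /dotv !mulr_sumr -!sumrN -!big_split/=; apply: eq_bigr => l _.
  by rewrite !tnth_mktuple; ring.
have sumd (f : 'I_d -> R) m : \sum_(l < d) (m == l)%:R * f l = f m.
  rewrite (bigD1 m)//= eqxx mul1r big1 ?addr0// => l /negbTE.
  by rewrite eq_sym => ->; rewrite mul0r.
rewrite !sumd; have -> : (j == i)%:R = (i == j)%:R :> R by rewrite eq_sym.
have [v0|v0] := eqVneq (dotv v v) 0; first by rewrite /c v0 invr0; ring.
by rewrite /c; field.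
Qed.

(** For a unit [th], |v|^2 = 2 - 2 th_k = -2 v_k. Hence c v_k = -1, and row k is e_k + v, which is
    [th]. *)
Lemma reflection_row_id th k : normv th = 1 -> reflection_row th k k = th.
Proof.
move=> th1; rewrite /reflection_row /=; set v := mktuple (fun j : 'I_d => tnth th j - (j == k)%:R).
have vv : dotv v v = - 2 * tnth v k.
  have -> : dotv v v = dotv th th - 2 * (\sum_(l < d) (l == k)%:R * tnth th l)
      + \sum_(l < d) (l == k)%:R * (l == k)%:R.
    rewrite /dotv mulr_sumr -sumrN -!big_split/=; apply: eq_bigr => l _.
    by rewrite !tnth_mktuple; ring.
  have sumd (f : 'I_d -> R) : \sum_(l < d) (l == k)%:R * f l = f k.
    rewrite (bigD1 k)//= eqxx mul1r big1 ?addr0// => l /negbTE.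
    by move=> ->; rewrite mul0r.
  by rewrite !sumd -sqr_normv th1 tnth_mktuple eqxx /=; ring.
apply: eq_from_tnth => j; rewrite !tnth_mktuple.
have [v0|v0] := eqVneq (dotv v v) 0.
  have := dotvv_eq0 j v0; rewrite v0 invr0 tnth_mktuple eq_sym => /eqP.
  by rewrite subr_eq0 => /eqP ->; rewrite mulr0 !mul0r subr0.
rewrite [j == k]eq_sym -[tnth th j - _]/(_); move: v0; rewrite vv => v0.
rewrite !tnth_mktuple eqxx in v0 *; field.
by move: v0; rewrite mulf_eq0 negb_or => /andP[].
Qed.

End Householder.

Section UniformOnSeq.
Local Open Scope ereal_scope.
Context d (T : measurableType d) (R : realType) (n : nat) (n0 : (0 < n)%N) (x : nat -> T).

Lemma uniform_on_points : exists P : probability T R,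
  (forall A, P A = (n%:R^-1)%:E * \sum_(i < n) \d_(x i) A) /\
  (forall f : T -> \bar R, measurable_fun setT f -> (forall y, 0 <= f y) ->
     \int[P]_y f y = (n%:R^-1)%:E * \sum_(i < n) f (x i)).
Proof.
have n0' : (0 <= n%:R^-1 :> R)%R by rewrite invr_ge0.
pose m : {measure set T -> \bar R} :=
  mscale (NngNum n0') (msum (fun i => \d_(x i)) n).
have mE A : m A = (n%:R^-1)%:E * \sum_(i < n) \d_(x i) A.
  by rewrite /m /= /mscale /= /msum.
have m1 : m setT = 1.
  rewrite mE; under eq_bigr do rewrite diracT.
  by rewrite sumEFin -EFinM sumr_const card_ord mulVf// pnatr_eq0 -lt0n.
have [P PE] := measure_probability m1.
exists P; split => [A|f mf f0]; first by rewrite PE.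
rewrite (eq_measure_integral m)/=; last by move=> A _ _; exact: PE.
rewrite ge0_integral_mscale//= ge0_integral_measure_sum//; congr (_ * _).
by apply: eq_bigr => i _; rewrite integral_dirac// diracT mul1e.
Qed.

End UniformOnSeq.

Section FullMass.
Local Open Scope ereal_scope.
Context (R : realType).
Import HBNNSimple.

(** Almost-everywhere monotonicity is applied to the simple functions below [f], which are
    measurable even when [f] is not known to be. *)
Lemma raw_integral_le_on d' (T : measurableType d') (P : probability T R)
    (A : set T) (f : T -> \bar R) (M : R) : measurable A -> P A = 1 ->
  (forall x, 0 <= f x) -> (forall x, A x -> f x <= M%:E) -> (0 <= M)%R ->
  \int[P]_x f x <= M%:E.
Proof.
move=> mA PA f0 fM M0; rewrite raw_integralE//.
apply: ge_ereal_sup => _ [h /= hf <-]; rewrite -integralT_nnsfun.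
apply: (@le_trans _ _ (\int[P]_x (cst M%:E) x)); last first.
  by rewrite integral_cst//= probability_setT mule1.
apply: ae_ge0_le_integral; [exact: measurableT| | | |exact: measurable_cst|].
- by move=> x _; rewrite lee_fin; exact: fun_ge0.
- by apply/measurable_EFinP; exact: measurable_funP.
- by move=> x _; rewrite lee_fin.
exists (~` A); split.
- exact: measurableC.
- by apply: etrans (probability_setC P mA) _; rewrite PA subee.
- move=> x /= H Ax; apply: H => _.
  by apply: le_trans (hf x) _; exact: fM.
Qed.

End FullMass.

Section Comparison.
Local Open Scope ereal_scope.
Context (R : realType) (d : nat) (p : R) (p1 : (1 <= p)%R) (d0 : (0 < d)%N).
Variables mu nu : probability (d.-tuple R) R.

Let p_gt0 : (0 < p)%R. Proof. exact: lt_le_trans p1. Qed.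
Let p_neq0 : p != 0%R. Proof. exact: lt0r_neq0. Qed.
Let pV_ge0 : (0 <= p^-1)%R. Proof. by rewrite invr_ge0 ltW. Qed.

Let S th := Wp1 p (radon mu th) (radon nu th).

Let S0 th : 0 <= S th. Proof. exact: Wasserstein_ge0. Qed.

Lemma Wp1_le_maxSW th : normv th = 1%R -> S th <= maxSW p mu nu.
Proof. by move=> th1; apply: ereal_sup_ubound; exists th. Qed.

(** A basis vector witnesses that the sphere is nonempty; the supremum of an empty family would be
    -oo. *)
Lemma maxSW_ge0 : 0 <= maxSW p mu nu.
Proof.
pose k := Ordinal d0; pose e : d.-tuple R := [tuple (i == k)%:R%R | i < d].
apply: le_trans (S0 e) (Wp1_le_maxSW _).
rewrite /normv (_ : dotv e e = 1%R) ?sqrtr1//.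
rewrite /dotv (bigD1 k)//= !tnth_mktuple eqxx mulr1 big1 ?addr0// => i ik.
by rewrite tnth_mktuple (negbTE ik) mul0r.
Qed.

Lemma maxSW_le_Wp : maxSW p mu nu <= Wp p mu nu.
Proof. by apply: ge_ereal_sup => _ [th th1 <-]; exact: Wp1_le_Wp. Qed.

Lemma SW_le_maxSW : SW p mu nu <= maxSW p mu nu.
Proof.
have := maxSW_ge0; case ME : (maxSW p mu nu) => [M| |]// M0; last by rewrite leey.
rewrite -[leRHS](poweRKV p1)//; apply: le_poweR => //.
  by apply: raw_integral_ge0; [exact: unif_sphere0|move=> x; exact: poweR_ge0].
rewrite poweR_EFin; apply: unif_sphere_integral_le => [x|th th1|].
- exact: poweR_ge0.
- by rewrite -poweR_EFin -ME; apply: le_poweR; [exact: ltW|exact: S0|exact: Wp1_le_maxSW].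
- exact: powR_ge0.
Qed.

Lemma DSW_le_maxSW (C : R) : DSW p mu nu C <= maxSW p mu nu.
Proof.
apply: ge_ereal_sup => _ [sg [[sg1 _] ->]].
have := maxSW_ge0; case ME : (maxSW p mu nu) => [M| |]// M0; last by rewrite leey.
rewrite -[leRHS](poweRKV p1)//; apply: le_poweR => //.
  by apply: integral_ge0 => x _; exact: poweR_ge0.
rewrite poweR_EFin; apply: (raw_integral_le_on (A := @sphere R d)) => //.
- exact: measurable_sphere.
- by move=> x; exact: poweR_ge0.
- by move=> th th1; rewrite -poweR_EFin -ME; apply: le_poweR;
    [exact: ltW|exact: S0|exact: Wp1_le_maxSW].
- exact: powR_ge0.
Qed.

(** Two independent uniform picks from an orthonormal basis have expected |<theta, theta'>| exactly
    1/d, which is where the threshold on [C] comes from; the prescribed direction has mass at least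
    1/d, which gives the constant. *)
Lemma DSW_ge_maxSW (C : R) : (d%:R^-1 <= C)%R ->
  ((d%:R^-1) `^ p^-1)%:E * maxSW p mu nu <= DSW p mu nu C.
Proof.
move=> dC; set a := (_ `^ _)%R.
have a0 : (0 < a)%R by rewrite powR_gt0// invr_gt0 ltr0n.
rewrite -lee_pdivlMl//; apply: ge_ereal_sup => _ [th th1 <-].
rewrite lee_pdivlMl//.
(* [uniform_on_points] takes a sequence indexed by [nat], so the rows are extended past [d] by row
   [k]. *)
pose k := Ordinal d0; pose b i : d.-tuple R := reflection_row th k (insubd k i).
have bE (i : 'I_d) : b i = reflection_row th k i by rewrite /b valKd.
have [P [PE PI]] := uniform_on_points R d0 b.
have dn0 : d%:R != 0%R :> R by rewrite pnatr_eq0 -lt0n.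
have b1 i : normv (b i) = 1%R by rewrite /normv dotv_reflection eqxx sqrtr1.
have PS : P (@sphere R d) = 1.
  rewrite PE (eq_bigr (fun=> 1)); last first.
    by move=> i _; rewrite diracE mem_set//; exact: b1.
  by rewrite sumEFin -EFinM sumr_const card_ord mulVf.
have mabs th' : measurable_fun setT (fun x : d.-tuple R => (`|dotv th' x|)%:E).
  apply/measurable_EFinP; apply: measurableT_comp => //.
  by apply: measurable_dotv => //; exact: measurable_cst.
have PMC : in_MC C P.
  split => //.
  under eq_integral do rewrite PI//.
  rewrite PI; last 2 first.
  - apply: emeasurable_funM => //; apply: emeasurable_sum => i.
    apply/measurable_EFinP; apply: measurableT_comp => //.
    by apply: measurable_dotv => //; exact: measurable_cst.
  - by move=> y; rewrite mule_ge0 ?lee_fin ?invr_ge0// sume_ge0.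
  rewrite (eq_bigr (fun=> (d%:R^-1)%:E)); last first.
    move=> i _; rewrite (bigD1 i)//= big1 ?adde0.
      by rewrite dotv_reflection eqxx normr1 mule1.
    move=> j ji; rewrite !bE dotv_reflection eq_sym (negbTE ji) normr0//.
  by rewrite sumEFin -EFinM sumr_const card_ord -[(d%:R^-1 *+ d)%R]mulr_natr mulVf// mulr1 lee_fin.
apply: (@le_trans _ _ ((\int[P]_th' (S th' `^ p)) `^ p^-1)); last first.
  by apply: ereal_sup_ubound; exists P.
have -> : a%:E * Wp1 p (radon mu th) (radon nu th) =
    ((d%:R^-1)%:E * S th `^ p) `^ p^-1.
  by rewrite poweRM ?poweR_ge0 ?lee_fin ?invr_ge0// poweRKV.
apply: le_poweR => //; first by rewrite mule_ge0 ?poweR_ge0 ?lee_fin ?invr_ge0.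
(* [PI] computes integrals of measurable functions only, so the slice cost is bounded below by
   Markov's inequality on the atom at [th], written as a zero set of the distance to make it
   measurable. *)
pose A := [set x | distv x th = 0%R].
have mA : measurable A.
  rewrite (_ : A = (fun x => distv x th) @^-1` [set 0%R])//.
  by rewrite -[X in measurable X]setTI; exact: measurable_distvl.
have PA : (d%:R^-1)%:E <= P A.
  rewrite PE -[leLHS]mule1; apply: lee_wpmul2l; first by rewrite lee_fin invr_ge0.
  rewrite (bigD1 k)// bE reflection_row_id// diracE mem_set; last first.
    rewrite /A/= /distv big1 ?sqrtr0// => i _; by rewrite subrr expr0n.
  by rewrite leeDl// sume_ge0.
have key (c : R) : (0 <= c)%R -> c%:E <= S th `^ p ->
    (d%:R^-1)%:E * c%:E <= \int[P]_th' (S th' `^ p).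
  move=> c0 cS; apply: (@le_trans _ _ (c%:E * P A)).
    by rewrite muleC; apply: lee_wpmul2l.
  apply: raw_integral_ge => // [x|x /distv_eq0 ->//].
  exact: poweR_ge0.
have := poweR_ge0 (S th) p.
move: key; case: (S th `^ p) => [r| |] key // r0; first exact: key.
rewrite gt0_muley ?lte_fin ?invr_gt0 ?ltr0n// leye_eq; case IE : (\int[P]_th' (S th' `^ p)) => [r'| |]//.
(* The slice cost at [th] is infinite here. A finite value r' of the integral is refuted by this
   [c], for which c / d = |r'| + 1. *)
- have := key (d%:R * (`|r'| + 1))%R; rewrite IE leey -EFinM mulKf// lee_fin.
  move=> /(_ _ isT); rewrite mulr_ge0 ?addr_ge0// => /(_ isT).
  by have := ler_norm r'; lra.
- have := key 0%R (lexx _) (leey _); by rewrite IE mule0.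
Qed.

End Comparison.

(** * Couplings from a partition of unity *)

Section DensityCoupling.
Local Open Scope ereal_scope.
Context d (T : measurableType d) (R : realType) (mu nu : probability T R).
Variable k : T * T -> R.
Hypotheses (mk : measurable_fun setT k) (k0 : forall z, (0 <= k z)%R).

(** The two proofs are arguments so that the measure structure can be attached to the term. *)
Definition density_measure of measurable_fun setT k & (forall z, (0 <= k z)%R) :
  set (T * T) -> \bar R := fun A => \int[mu \x nu]_(z in A) (k z)%:E.

Local Notation dm := (density_measure mk k0).

Let mkE : measurable_fun setT (fun z => (k z)%:E).
Proof. exact/measurable_EFinP. Qed.

Let dm0 : dm set0 = 0.
Proof. by rewrite /density_measure integral_set0. Qed.

Let dm_ge0 A : 0 <= dm A.
Proof. by apply: integral_ge0 => z _; rewrite lee_fin. Qed.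

Let dm_sigma_additive : semi_sigma_additive dm.
Proof.
move=> F mF tF mUF; rewrite /density_measure ge0_integral_bigcup//.
- apply: is_cvg_ereal_nneg_natsum_cond => n _ _.
  by apply: integral_ge0 => z _; rewrite lee_fin.
- exact: measurable_funS mkE.
- by move=> z _; rewrite lee_fin.
Qed.

HB.instance Definition _ := isMeasure.Build _ _ _ dm dm0 dm_ge0 dm_sigma_additive.

Import HBNNSimple.

Let dmE A : measurable A -> dm A = \int[mu \x nu]_z (\1_A z * k z)%:E.
Proof.
move=> mA; rewrite /density_measure integral_mkcond; apply: eq_integral => z _.
by rewrite patchE indicE; case: (_ \in _); rewrite ?mul1r ?mul0r.
Qed.

(** An upper bound is all that a transport cost requires. Each simple function below [f] is
    integrated level set by level set, so the cost [f] may be any nonnegative function. *)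
Lemma integral_density_le (f : T * T -> R) :
  (forall z, (0 <= f z)%R) ->
  \int[dm]_z (f z)%:E <= \int[mu \x nu]_z (f z * k z)%:E.
Proof.
move=> f0; rewrite [leLHS]raw_integralE//.
apply: ge_ereal_sup => _ [h /= hf <-].
apply: (@le_trans _ _ (\int[mu \x nu]_z (h z * k z)%:E)); last first.
  apply: le_raw_integral => // z.
    by rewrite lee_fin mulr_ge0//; exact: fun_ge0.
  by rewrite lee_fin ler_wpM2r// -lee_fin.
have m1 (x : R) : measurable_fun setT (fun z : T * T => (\1_(h @^-1` [set x]) z * k z)%R).
  by apply: measurable_funM => //; exact: measurable_indic.
have -> : \int[mu \x nu]_z (h z * k z)%:E = \int[mu \x nu]_z
    (\sum_(x \in range h) (x * (\1_(h @^-1` [set x]) z * k z))%:E).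
  apply: eq_integral => z _; rewrite fsumEFin//; congr (_%:E).
  rewrite {1}fimfunE !fsbig_finite//= mulr_suml.
  by apply: eq_bigr => x _; rewrite mulrA.
rewrite ge0_integral_fsum//; last 2 first.
- by move=> x; apply/measurable_EFinP; exact: measurable_funM.
- move=> x z _; rewrite lee_fin indicE.
  have [/set_mem /= <-|] := boolP (z \in _); last by rewrite mul0r mulr0.
  by rewrite mul1r mulr_ge0//; exact: fun_ge0.
rewrite sintegralE; rewrite le_eqVlt; apply/orP; left; apply/eqP.
apply: eq_fsbigr => x /set_mem[z _ <-].
rewrite /= dmE//; under [in RHS]eq_integral do rewrite EFinM.
rewrite ge0_integralZl_EFin//.
- by move=> y _; rewrite lee_fin mulr_ge0.
- exact/measurable_EFinP.
Qed.

Hypotheses (k1 : forall x, \int[nu]_y (k (x, y))%:E = 1)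
           (k2 : forall y, \int[mu]_x (k (x, y))%:E = 1).

Lemma density_coupling : exists pi : probability (T * T)%type R,
  coupling mu nu pi /\ forall f : T * T -> R, (forall z, (0 <= f z)%R) ->
    \int[pi]_z (f z)%:E <= \int[mu \x nu]_z (f z * k z)%:E.
Proof.
have mM (g : T -> R) (F : T * T -> T) : measurable_fun setT g -> measurable_fun setT F ->
    measurable_fun setT (fun z => (g (F z) * k z)%:E).
  move=> mg mF; apply/measurable_EFinP; apply: measurable_funM => //.
  exact: (measurableT_comp mg mF).
have mar1 A : measurable A -> dm (A `*` setT) = mu A.
  move=> mA; rewrite dmE; last exact: measurableX.
  have m1A : measurable_fun setT (\1_A : T -> R) by exact: measurable_indic.
  transitivity (\int[mu \x nu]_z (\1_A z.1 * k z)%:E).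
    apply: eq_integral => -[x y] _ /=; congr (_ * _)%:E; rewrite !indicE.
    by congr (nat_of_bool _)%:R; apply/idP/idP => [/set_mem[/= ? _]|/set_mem ?]; exact/mem_set.
  rewrite fubini_tonelli1//; last 2 first.
  - exact: (mM _ _ m1A measurable_fst).
  - by move=> z; rewrite lee_fin mulr_ge0.
  transitivity (\int[mu]_x (\1_A x)%:E); last by rewrite integral_indic// setIT.
  apply: eq_integral => x _.
  rewrite /fubini_F /=; under eq_integral do rewrite EFinM.
  rewrite ge0_integralZl_EFin//; first by rewrite k1 mule1.
    by move=> y _; rewrite lee_fin.
  by apply: (measurableT_comp mkE); exact: measurable_pair1.
have mar2 A : measurable A -> dm (setT `*` A) = nu A.
  move=> mA; rewrite dmE; last exact: measurableX.
  have m1A : measurable_fun setT (\1_A : T -> R) by exact: measurable_indic.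
  transitivity (\int[mu \x nu]_z (\1_A z.2 * k z)%:E).
    apply: eq_integral => -[x y] _ /=; congr (_ * _)%:E; rewrite !indicE.
    by congr (nat_of_bool _)%:R; apply/idP/idP => [/set_mem[/= _ ?]|/set_mem ?]; exact/mem_set.
  rewrite fubini_tonelli2//; last 2 first.
  - exact: (mM _ _ m1A measurable_snd).
  - by move=> z; rewrite lee_fin mulr_ge0.
  transitivity (\int[nu]_y (\1_A y)%:E); last by rewrite integral_indic// setIT.
  apply: eq_integral => y _.
  rewrite /fubini_G /=; under eq_integral do rewrite EFinM.
  rewrite ge0_integralZl_EFin//; first by rewrite k2 mule1.
    by move=> x _; rewrite lee_fin.
  by apply: (measurableT_comp mkE); exact: measurable_pair2.
have dm1 : dm setT = 1 by rewrite -setXTT mar1// probability_setT.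
have [pi piE] := measure_probability dm1.
exists pi; split => [A mA|f f0]; first by rewrite -(mar1 A mA) -(mar2 A mA); split; exact: piE.
rewrite (eq_measure_integral dm)/=; last by move=> A _ _; exact: piE.
exact: integral_density_le.
Qed.

End DensityCoupling.

Section BoundedIntegrals.
Context d (T : measurableType d) (R : realType) (P : probability T R).

Lemma bounded_integrable (f : T -> R) (M : R) : measurable_fun setT f ->
  (forall x, `|f x| <= M) -> P.-integrable setT (EFin \o f).
Proof.
move=> mf fM; apply: measurable_bounded_integrable => //.
  by rewrite (le_lt_trans (probability_le1 _ _))// ltry.
by exists M; split; [exact: num_real|move=> y My x _; apply: le_trans (fM x) (ltW My)].
Qed.

(** With one variable frozen, the coupling density below is an affine combination of the weights
    [g i] of the other variable; this formula evaluates all its partial integrals. *)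
Lemma integral_affine (I : finType) (g : I -> T -> R) (M : R) (a : R) (c : I -> R) :
  (forall i, measurable_fun setT (g i)) -> (forall i x, `|g i x| <= M) ->
  (\int[P]_x (a + \sum_i c i * g i x)%:E =
   (a + \sum_i c i * \int[P]_x g i x)%:E)%E.
Proof.
move=> mg gM.
have ig i : P.-integrable setT (EFin \o g i) by exact: (bounded_integrable (mg i) (gM i)).
under eq_integral do rewrite EFinD.
rewrite integralD//; last 2 first.
- exact: finite_measure_integrable_cst.
- rewrite (_ : (fun x => _) = fun x => (\sum_i (c i)%:E * (g i x)%:E)%E).
    by apply: integrable_sum => // i _; exact: (integrableZl measurableT (c i) (ig i)).
  by apply/funext => x; rewrite -sumEFin.
rewrite integral_cst// [X in (_ * X)%E](_ : _ = 1%E) ?mule1; last exact: probability_setT.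
rewrite EFinD; congr (_ + _)%E; rewrite -sumEFin.
transitivity (\int[P]_x (\sum_i (c i)%:E * (g i x)%:E))%E.
  by apply: eq_integral => x _; rewrite -sumEFin.
rewrite integral_sum//; last by move=> i; exact: (integrableZl measurableT (c i) (ig i)).
apply: eq_bigr => i _; rewrite (integralZl measurableT (ig i)) EFinM; congr (_ * _)%E.
by rewrite /Rintegral fineK//; exact: (integrable_fin_num measurableT (ig i)).
Qed.

End BoundedIntegrals.

Section PartitionCoupling.
Context d (T : measurableType d) (R : realType) (mu nu : probability T R).
Context (I : finType) (g : I -> T -> R).
Hypotheses (mg : forall i, measurable_fun setT (g i))
  (g0 : forall i x, 0 <= g i x) (g1 : forall x, \sum_i g i x = 1).

Let gM i x : `|g i x| <= 1.
Proof. by rewrite ger0_norm// -(g1 x) (bigD1 i)//= lerDl sumr_ge0. Qed.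

Let p i := \int[mu]_x g i x.
Let q i := \int[nu]_x g i x.

Let p0 i : 0 <= p i. Proof. by apply: Rintegral_ge0. Qed.
Let q0 i : 0 <= q i. Proof. by apply: Rintegral_ge0. Qed.

Lemma partition_sum_integral (P : probability T R) : \sum_i \int[P]_x g i x = 1.
Proof.
have := integral_affine P 0 (fun=> 1) mg gM.
under eq_integral do (rewrite add0r; under eq_bigr do rewrite mul1r; rewrite g1).
rewrite integral_cst// [X in (_ * X)%E](_ : _ = 1%E) ?mule1; last exact: probability_setT.
by move=> [/esym]; rewrite add0r; under eq_bigr do rewrite mul1r.
Qed.

Variables (dl : R) (dl0 : 0 < dl) (dl1 : dl <= 1).

(* Mass [(1 - dl) min(p_i, q_i)] is coupled inside the [i]-th cell; the factor
   [1 - dl < 1] keeps the leftover mass [m] positive. *)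
Let a i := (1 - dl) * Num.min (p i) (q i).
(** Normalization giving the product [b i * g i x * g i y] total mass [a i]. If [p i] or [q i]
    vanishes, both [a i] and [b i] are 0. *)
Let b i := a i / (p i * q i).
Let m := 1 - \sum_i a i.

Let dl'0 : 0 <= 1 - dl. Proof. by rewrite subr_ge0. Qed.
Let a0 i : 0 <= a i. Proof. by rewrite mulr_ge0// le_min p0 q0. Qed.
Let b0 i : 0 <= b i. Proof. by rewrite divr_ge0// mulr_ge0. Qed.

Let bpq i : b i * p i * q i = a i.
Proof.
rewrite /b /a; have [->|pi0] := eqVneq (p i) 0.
  by rewrite min_l ?q0// !(mulr0, mul0r).
have [->|qi0] := eqVneq (q i) 0; first by rewrite min_r ?p0// !(mulr0, mul0r).
by field; rewrite pi0 qi0.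
Qed.

Let ap i : a i <= p i.
Proof.
rewrite -[leRHS]mul1r; apply: ler_pM; rewrite ?le_min ?p0 ?q0 ?ge_min ?lexx//.
by rewrite gerBl ltW.
Qed.

Let aq i : a i <= q i.
Proof.
rewrite -[leRHS]mul1r; apply: ler_pM; rewrite ?le_min ?p0 ?q0 ?ge_min ?lexx ?orbT//.
by rewrite gerBl ltW.
Qed.

Let bp i : b i * p i <= 1.
Proof.
have [qi0|qi0] := eqVneq (q i) 0; first by rewrite /b qi0 mulr0 invr0 mulr0 mul0r.
have qi : 0 < q i by rewrite lt_def qi0 q0.
by rewrite -(ler_pM2r qi) bpq mul1r.
Qed.

Let bq i : b i * q i <= 1.
Proof.
have [pi0|pi0] := eqVneq (p i) 0; first by rewrite /b pi0 mul0r invr0 mulr0 mul0r.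
have pi : 0 < p i by rewrite lt_def pi0 p0.
by rewrite -(ler_pM2r pi) mulrAC bpq mul1r.
Qed.

(** [u] and [v] are the densities, with respect to [mu] and [nu], of the mass that the cell terms
    leave uncoupled. *)
Let u x := 1 - \sum_i b i * q i * g i x.
Let v x := 1 - \sum_i b i * p i * g i x.

Let u0 x : 0 <= u x.
Proof. by rewrite subr_ge0 -(g1 x); apply: ler_sum => i _; rewrite ler_piMl. Qed.

Let v0 x : 0 <= v x.
Proof. by rewrite subr_ge0 -(g1 x); apply: ler_sum => i _; rewrite ler_piMl. Qed.

Let m_gt0 : 0 < m.
Proof.
rewrite subr_gt0; apply: (@le_lt_trans _ _ (\sum_i (1 - dl) * p i)).
  by apply: ler_sum => i _; rewrite ler_wpM2l// ge_min lexx.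
by rewrite -mulr_sumr partition_sum_integral mulr1 gtrBl.
Qed.

Let m0 : m != 0. Proof. exact: lt0r_neq0. Qed.

Let mass_uE : 1 - \sum_i b i * q i * p i = m.
Proof. by rewrite /m; congr (1 - _); apply: eq_bigr => i _; rewrite mulrAC bpq. Qed.

Let mass_vE : 1 - \sum_i b i * p i * q i = m.
Proof. by rewrite /m; congr (1 - _); apply: eq_bigr => i _; rewrite bpq. Qed.

(** The sum couples each cell with itself; the leftovers, both of mass [m], are coupled
    independently, and dividing by [m] restores the right marginals. *)
Let k z := \sum_i b i * g i z.1 * g i z.2 + u z.1 * v z.2 / m.

Let bgg0 i x y : 0 <= b i * g i x * g i y.
Proof. exact: mulr_ge0 (mulr_ge0 (b0 i) (g0 i x)) (g0 i y). Qed.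

Let k0 z : 0 <= k z.
Proof.
apply: addr_ge0; last by apply: divr_ge0; [exact: mulr_ge0|exact: ltW].
by apply: sumr_ge0.
Qed.

Let msum_g (c : I -> R) : measurable_fun setT (fun x => \sum_i c i * g i x).
Proof. by apply: measurable_sum => i; apply: measurable_funM. Qed.

Let mu_ : measurable_fun setT u. Proof. exact: measurable_funB. Qed.
Let mv : measurable_fun setT v. Proof. exact: measurable_funB. Qed.

Let m1 (f : T -> R) : measurable_fun setT f ->
  measurable_fun setT (fun z : T * T => f z.1).
Proof. by move=> mf; exact: (measurableT_comp mf measurable_fst). Qed.

Let m2 (f : T -> R) : measurable_fun setT f ->
  measurable_fun setT (fun z : T * T => f z.2).
Proof. by move=> mf; exact: (measurableT_comp mf measurable_snd). Qed.

Let mk : measurable_fun setT k.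
Proof.
apply: measurable_funD.
  apply: measurable_sum => i; apply: measurable_funM; last exact: m2.
  by apply: measurable_funM => //; exact: m1.
by apply: measurable_funM => //; apply: measurable_funM; [exact: m1|exact: m2].
Qed.

Let kE1 x y : k (x, y) = u x / m + \sum_i (b i * g i x - u x / m * (b i * p i)) * g i y.
Proof.
rewrite /k /= mulrAC {1}/v mulrBr mulr1 mulr_sumr addrCA -sumrB; congr (_ + _).
by apply: eq_bigr => i _; ring.
Qed.

Let kE2 x y : k (x, y) = v y / m + \sum_i (b i * g i y - v y / m * (b i * q i)) * g i x.
Proof.
rewrite /k /= -mulrA [u x * _]mulrC {1}/u mulrBr mulr1 mulr_sumr addrCA -sumrB.
by congr (_ + _); apply: eq_bigr => i _; ring.
Qed.

Let k1 x : (\int[nu]_y (k (x, y))%:E = 1)%E.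
Proof.
under eq_integral do rewrite kE1.
rewrite (integral_affine nu _ _ mg gM); congr (_%:E).
rewrite (eq_bigr (fun i => b i * q i * g i x - u x / m * (b i * p i * q i))); last first.
  by move=> i _; rewrite -/(q i); ring.
rewrite sumrB -mulr_sumr.
have -> : \sum_i b i * p i * q i = 1 - m by rewrite -mass_vE; ring.
have -> : \sum_i b i * q i * g i x = 1 - u x by rewrite /u; ring.
by field.
Qed.

Let k2 y : (\int[mu]_x (k (x, y))%:E = 1)%E.
Proof.
under eq_integral do rewrite kE2.
rewrite (integral_affine mu _ _ mg gM); congr (_%:E).
rewrite (eq_bigr (fun i => b i * p i * g i y - v y / m * (b i * q i * p i))); last first.
  by move=> i _; rewrite -/(p i); ring.
rewrite sumrB -mulr_sumr.
have -> : \sum_i b i * q i * p i = 1 - m by rewrite -mass_uE; ring.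
have -> : \sum_i b i * p i * g i y = 1 - v y by rewrite /v; ring.
by field.
Qed.

(** [tau] pays for far away points, [V i] for the deviation from the centre of cell [i], with
    weighted mean at most [B], and [D] bounds the rest of the cost when the two points share no
    cell. Thus [cV] serves the cell terms of [k] and [cD] its leftover term. *)
Variables (tau : T -> R) (V : I -> T -> R) (B D : R) (c : T * T -> R).
Hypotheses (mtau : measurable_fun setT tau) (tau0 : forall x, 0 <= tau x)
  (mV : forall i, measurable_fun setT (V i)) (V0 : forall i x, 0 <= V i x)
  (gVB : forall x, \sum_i g i x * V i x <= B) (D0 : 0 <= D)
  (c0 : forall z, 0 <= c z)
  (cD : forall x y, c (x, y) <= tau x + tau y + D)
  (cV : forall i x y, c (x, y) <= tau x + tau y + V i x + V i y).

(** The cost is split by payer: [P1] and [P2] collect what is charged to the first and to the second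
    point, [P3] the constant charged to the leftover. *)
Let P1 z := k z * tau z.1 + \sum_i b i * V i z.1 * g i z.1 * g i z.2.
Let P2 z := k z * tau z.2 + \sum_i b i * V i z.2 * g i z.2 * g i z.1.
Let P3 z := D * (u z.1 * v z.2 / m).

Let bVgg0 i x y : 0 <= b i * V i x * g i x * g i y.
Proof. exact: mulr_ge0 (mulr_ge0 (mulr_ge0 (b0 i) (V0 i x)) (g0 i x)) (g0 i y). Qed.

Let P1_ge0 z : 0 <= P1 z.
Proof.
by apply: addr_ge0; [exact: mulr_ge0|apply: sumr_ge0 => i _; exact: bVgg0].
Qed.
Let P2_ge0 z : 0 <= P2 z.
Proof.
by apply: addr_ge0; [exact: mulr_ge0|apply: sumr_ge0 => i _; exact: bVgg0].
Qed.
Let P3_ge0 z : 0 <= P3 z.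
Proof. by apply: mulr_ge0 => //; apply: divr_ge0; [exact: mulr_ge0|exact: ltW]. Qed.

Let mP1 : measurable_fun setT P1.
Proof.
apply: measurable_funD; first by apply: measurable_funM => //; exact: m1.
apply: measurable_sum => i; apply: measurable_funM; last exact: m2.
by apply: measurable_funM; [apply: measurable_funM => //; exact: m1|exact: m1].
Qed.

Let mP2 : measurable_fun setT P2.
Proof.
apply: measurable_funD; first by apply: measurable_funM => //; exact: m2.
apply: measurable_sum => i; apply: measurable_funM; last exact: m1.
by apply: measurable_funM; [apply: measurable_funM => //; exact: m2|exact: m2].
Qed.

Let mP3 : measurable_fun setT P3.
Proof.
apply: measurable_funM => //.
by apply: measurable_funM => //; apply: measurable_funM; [exact: m1|exact: m2].
Qed.

Let ck_le z : c z * k z <= P1 z + P2 z + P3 z.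
Proof.
case: z => x y; rewrite /P1 /P2 /P3 /=.
have -> : k (x, y) = \sum_i b i * g i x * g i y + u x * v y / m by [].
set r := u x * v y / m.
have r0 : 0 <= r by apply: divr_ge0; [exact: mulr_ge0|exact: ltW].
have H1 : c (x, y) * r <= (tau x + tau y + D) * r by rewrite ler_wpM2r.
have H2 : c (x, y) * (\sum_i b i * g i x * g i y) <=
    (tau x + tau y) * (\sum_i b i * g i x * g i y) +
    (\sum_i b i * V i x * g i x * g i y + \sum_i b i * V i y * g i y * g i x).
  rewrite !mulr_sumr -!big_split/=; apply: ler_sum => i _.
  have : c (x, y) * (b i * g i x * g i y) <=
    (tau x + tau y + V i x + V i y) * (b i * g i x * g i y).
    by rewrite ler_wpM2r.
  move/le_trans; apply; rewrite le_eqVlt; apply/orP; left; apply/eqP; ring.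
move: H1 H2; set s := \sum_i _; set s1 := \sum_i _; set s2 := \sum_i _.
by move=> H1 H2; nra.
Qed.

(** Integrating the second variable first turns [k] into 1, which leaves [tau x], and turns the cell
    terms into the sum of b_i q_i g_i V_i, at most [B] since b_i q_i <= 1. *)
Let int_P1 : (\int[mu \x nu]_z (P1 z)%:E <= \int[mu]_x (tau x)%:E + B%:E)%E.
Proof.
rewrite fubini_tonelli1; last 2 first.
- exact/measurable_EFinP.
- by move=> z; rewrite lee_fin.
apply: (@le_trans _ _ (\int[mu]_x ((tau x)%:E + B%:E))%E).
  apply: le_raw_integral => [|x|x]; first by rewrite measure0.
    by apply: integral_ge0 => y _; rewrite lee_fin.
  rewrite /fubini_F /P1 /=.
  have E y : k (x, y) * tau x + \sum_i b i * V i x * g i x * g i y =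
     u x / m * tau x + \sum_i ((b i * g i x - u x / m * (b i * p i)) * tau x
        + b i * V i x * g i x) * g i y.
    rewrite kE1 mulrDl mulr_suml -addrA -big_split/=; congr (_ + _).
    by apply: eq_bigr => i _; ring.
  under eq_integral do rewrite E.
  rewrite (integral_affine nu _ _ mg gM) -EFinD lee_fin.
  have H : u x / m + \sum_i (b i * g i x - u x / m * (b i * p i)) * q i = 1.
    have := k1 x; under eq_integral do rewrite kE1.
    by rewrite (integral_affine nu _ _ mg gM) => -[].
  apply: (@le_trans _ _ (1 * tau x + \sum_i b i * q i * (g i x * V i x))).
    rewrite -H [(_ + \sum_i _) * tau _]mulrDl mulr_suml -addrA -big_split/= lerD2l le_eqVlt; apply/orP; left; apply/eqP.
    by apply: eq_bigr => i _; rewrite -/(q i); ring.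
  rewrite mul1r lerD2l; apply: le_trans (gVB x); apply: ler_sum => i _.
  by rewrite ler_piMl// mulr_ge0.
rewrite ge0_integralD; last 5 first.
- exact: measurableT.
- by move=> x _; rewrite lee_fin.
- exact/measurable_EFinP.
- by move=> x _; rewrite lee_fin; apply: le_trans (gVB x); apply: sumr_ge0 => i _; rewrite mulr_ge0.
- exact: measurable_cst.
rewrite integral_cst// [X in (_ * X)%E](_ : _ = 1%E) ?mule1//; exact: probability_setT.
Qed.

Let int_P2 : (\int[mu \x nu]_z (P2 z)%:E <= \int[nu]_x (tau x)%:E + B%:E)%E.
Proof.
rewrite fubini_tonelli2; last 2 first.
- exact/measurable_EFinP.
- by move=> z; rewrite lee_fin.
apply: (@le_trans _ _ (\int[nu]_x ((tau x)%:E + B%:E))%E).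
  apply: le_raw_integral => [|x|y]; first by rewrite measure0.
    by apply: integral_ge0 => y _; rewrite lee_fin.
  rewrite /fubini_G /P2 /=.
  have E x : k (x, y) * tau y + \sum_i b i * V i y * g i y * g i x =
     v y / m * tau y + \sum_i ((b i * g i y - v y / m * (b i * q i)) * tau y
        + b i * V i y * g i y) * g i x.
    rewrite kE2 mulrDl mulr_suml -addrA -big_split/=; congr (_ + _).
    by apply: eq_bigr => i _; ring.
  under eq_integral do rewrite E.
  rewrite (integral_affine mu _ _ mg gM) -EFinD lee_fin.
  have H : v y / m + \sum_i (b i * g i y - v y / m * (b i * q i)) * p i = 1.
    have := k2 y; under eq_integral do rewrite kE2.
    by rewrite (integral_affine mu _ _ mg gM) => -[].
  apply: (@le_trans _ _ (1 * tau y + \sum_i b i * p i * (g i y * V i y))).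
    rewrite -H [(_ + \sum_i _) * tau _]mulrDl mulr_suml -addrA -big_split/= lerD2l le_eqVlt; apply/orP; left; apply/eqP.
    by apply: eq_bigr => i _; rewrite -/(p i); ring.
  rewrite mul1r lerD2l; apply: le_trans (gVB y); apply: ler_sum => i _.
  by rewrite ler_piMl// mulr_ge0.
rewrite ge0_integralD; last 5 first.
- exact: measurableT.
- by move=> x _; rewrite lee_fin.
- exact/measurable_EFinP.
- by move=> x _; rewrite lee_fin; apply: le_trans (gVB x); apply: sumr_ge0 => i _; rewrite mulr_ge0.
- exact: measurable_cst.
rewrite integral_cst// [X in (_ * X)%E](_ : _ = 1%E) ?mule1//; exact: probability_setT.
Qed.

(** Both leftover densities have integral [m], so the product divided by [m] has mass [m]. *)
Let int_P3 : (\int[mu \x nu]_z (P3 z)%:E = (D * m)%:E)%E.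
Proof.
rewrite fubini_tonelli1; last 2 first.
- exact/measurable_EFinP.
- by move=> z; rewrite lee_fin.
transitivity (\int[mu]_x (D + \sum_i (- (D * (b i * q i))) * g i x)%:E)%E.
  apply: eq_integral => x _; rewrite /fubini_F /P3 /=.
  have E y : D * (u x * v y / m) = D * u x / m +
      \sum_i (- (D * u x / m * (b i * p i))) * g i y.
    rewrite (eq_bigr (fun i => - (D * u x / m) * (b i * p i * g i y))); last first.
      by move=> i _; ring.
    rewrite -mulr_sumr.
    have -> : \sum_i b i * p i * g i y = 1 - v y by rewrite /v; ring.
    by field.
  under eq_integral do rewrite E.
  rewrite (integral_affine nu _ _ mg gM); congr (_%:E).
  rewrite (eq_bigr (fun i => - (D * u x / m) * (b i * p i * q i))); last first.
    by move=> i _; rewrite -/(q i); ring.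
  rewrite -mulr_sumr.
  have -> : \sum_i b i * p i * q i = 1 - m by rewrite -mass_vE; ring.
  rewrite (eq_bigr (fun i => - D * (b i * q i * g i x))); last by move=> i _; ring.
  rewrite -mulr_sumr.
  have -> : \sum_i b i * q i * g i x = 1 - u x by rewrite /u; ring.
  by field.
rewrite (integral_affine mu _ _ mg gM); congr (_%:E).
rewrite (eq_bigr (fun i => - D * (b i * q i * p i))); last first.
  by move=> i _; rewrite -/(p i); ring.
rewrite -mulr_sumr -mass_uE; ring.
Qed.

(** The factor of [D] is the leftover mass [m], small once both measures give nearly equal mass to
    every cell and [dl] is small. *)
Lemma partition_coupling : exists pi : probability (T * T)%type R,
  coupling mu nu pi /\
  (\int[pi]_z (c z)%:E <= \int[mu]_x (tau x)%:E + \int[nu]_x (tau x)%:E +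
    (B *+ 2 + D * (1 - (1 - dl) *
        \sum_i Num.min (\int[mu]_x g i x) (\int[nu]_x g i x)))%:E)%E.
Proof.
have [pi [cpl H]] := density_coupling mk k0 k1 k2.
exists pi; split => //; apply: le_trans (H c c0) _.
apply: (@le_trans _ _ (\int[mu \x nu]_z ((P1 z)%:E + (P2 z)%:E + (P3 z)%:E))%E).
  apply: le_raw_integral => [|z|z]; first by rewrite measure0.
    by rewrite lee_fin mulr_ge0.
  by rewrite -!EFinD lee_fin.
rewrite ge0_integralD; last 5 first.
- exact: measurableT.
- by move=> z _; rewrite -EFinD lee_fin addr_ge0.
- by apply: emeasurable_funD; exact/measurable_EFinP.
- by move=> z _; rewrite lee_fin.
- exact/measurable_EFinP.
rewrite ge0_integralD; last 5 first.
- exact: measurableT.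
- by move=> z _; rewrite lee_fin.
- exact/measurable_EFinP.
- by move=> z _; rewrite lee_fin.
- exact/measurable_EFinP.
rewrite int_P3 mulr_sumr -/m; apply: le_trans (leeD2r _ (leeD int_P1 int_P2)) _.
by rewrite addeACA mulr2n -[leLHS]addeA; exact: lexx.
Qed.

End PartitionCoupling.

(** * Tails and trigonometric estimates *)

Section Trig.
Context (R : realType).
Implicit Types x y : R.

Lemma cos_lipschitz x y : `|cos x - cos y| <= `|x - y|.
Proof.
wlog xy : x y / x < y.
  move=> W; have [xy|yx|->] := ltgtP x y; first exact: W.
    by rewrite distrC [leRHS]distrC; exact: W.
  by rewrite !subrr.
rewrite distrC [leRHS]distrC.
have [c _ ->] := @MVT R cos (fun z => - sin z) x y xy
  (fun z _ => is_derive_cos z) (continuous_subspaceT (@continuous_cos R)).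
by rewrite normrM ler_piMl// normrN sin_max.
Qed.

(** Mean value theorem: the derivative of sine on [-1, 1] is at least cos 1, which is positive. So
    distances can be recovered from bounded sine coordinates. *)
Lemma sin_expand x y : `|x| <= 1 -> `|y| <= 1 -> cos 1 * `|x - y| <= `|sin x - sin y|.
Proof.
wlog xy : x y / x < y.
  move=> W x1 y1; have [xy|yx|->] := ltgtP x y; first exact: W.
    by rewrite distrC [leRHS]distrC; exact: W.
  by rewrite !subrr normr0 mulr0.
rewrite !ler_norml => /andP[x1 x2] /andP[y1 y2].
rewrite distrC [leRHS]distrC.
have [c] := @MVT R sin cos x y xy
  (fun z _ => is_derive_sin z) (continuous_subspaceT (@continuous_sin R)).
rewrite in_itv/= => /andP[xc cy] ->.
have c1 : `|c| <= 1 by rewrite ler_norml; apply/andP; split; lra.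
have pi1 := @pi_ge2 R.
have cc : cos 1 <= cos c.
  rewrite -(cos_norm c) leNgt ltr_cos -?leNgt// in_itv/= ?ler01 ?normr_ge0/=; lra.
by rewrite normrM ler_wpM2r//; apply: le_trans cc (ler_norm _).
Qed.

End Trig.

Section ErealCvg.
Context (R : realType).

Lemma cvge0P (u : nat -> \bar R) : (forall n, (0 <= u n)%E) ->
  (u @ \oo --> (0%E : \bar R)) <->
  (forall e : R, 0 < e -> \forall n \near \oo, (u n <= e%:E)%E).
Proof.
move=> u0; split.
  move=> /fine_cvgP[uf /cvgrPdist_lt uc] e e0.
  near=> n; have ufn : u n \is a fin_num by near: n.
  rewrite -(fineK ufn) lee_fin; apply: le_trans (ler_norm _) _.
  rewrite -normrN -[- _]add0r; apply: ltW.
  by near: n; exact: uc.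
move=> H; apply/fine_cvgP.
split.
  near=> n; rewrite ge0_fin_numE//.
  apply: (@le_lt_trans _ _ (1%:E)); last exact: ltry.
  by near: n; exact: H.
apply/cvgrPdist_lt => e e0; near=> n.
have ue : (u n <= (e / 2)%:E)%E by near: n; apply: H; rewrite divr_gt0.
have uf : u n \is a fin_num by rewrite ge0_fin_numE// (le_lt_trans ue)// ltry.
rewrite sub0r normrN /= ger0_norm ?fine_ge0//.
rewrite -lte_fin fineK//; apply: le_lt_trans ue _; rewrite lte_fin; lra.
Unshelve. all: by end_near. Qed.

End ErealCvg.

Section Tails.
Context (R : realType) (p : R) (p1 : 1 <= p).
Implicit Types (L a b : R).

Let p_gt0 : 0 < p. Proof. exact: lt_le_trans p1. Qed.
Let p_ge0 : 0 <= p. Proof. exact: ltW. Qed.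

(* The part of a p-th moment carried by norms exceeding [L]. *)
Definition tailpow L a : R := (L < a)%R%:R * a `^ p.

Lemma tailpow_ge0 L a : 0 <= tailpow L a.
Proof. by rewrite mulr_ge0// powR_ge0. Qed.

Lemma tailpow_gt L a : L < a -> tailpow L a = a `^ p.
Proof. by rewrite /tailpow => ->; rewrite mul1r. Qed.

Lemma tailpow_le L a : tailpow L a <= a `^ p.
Proof. by rewrite ler_piMl ?powR_ge0//; case: (_ < _). Qed.

Lemma tailpow_mono L a b : 0 <= a -> a <= b -> tailpow L a <= tailpow L b.
Proof.
move=> a0 ab; have [La|aL] := ltP L a; last first.
  by rewrite {1}/tailpow ltNge aL mul0r tailpow_ge0.
by rewrite !tailpow_gt ?(lt_le_trans La)// ge0_ler_powR// nnegrE//; exact: le_trans ab.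
Qed.

Lemma tailpow_anti L L' a : L <= L' -> tailpow L' a <= tailpow L a.
Proof.
move=> LL'; have [La|aL] := ltP L' a; last by rewrite {1}/tailpow ltNge aL mul0r tailpow_ge0.
by rewrite !tailpow_gt// (le_lt_trans LL').
Qed.

Lemma measurable_tailpow d (T : measurableType d) (f : T -> R) L :
  measurable_fun setT f -> measurable_fun setT (fun x => tailpow L (f x)).
Proof.
move=> mf; apply: measurable_funM; last exact: (measurableT_comp (measurable_powR p) mf).
rewrite (_ : (fun x => _) = \1_(f @^-1` `]L, +oo[)).
  by apply: measurable_indic; rewrite -[X in measurable X]setTI; exact: mf.
apply/funext => x; rewrite indicE; congr (nat_of_bool _)%:R.
apply/idP/idP => [Lx|/set_mem /=]; first by apply/mem_set; rewrite /= in_itv/= Lx.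
by rewrite in_itv/= andbT.
Qed.

Lemma powR_le_scale a b c : 0 <= a -> 0 <= b -> 0 <= c -> a <= c * b ->
  a `^ p <= c `^ p * b `^ p.
Proof.
move=> a0 b0 c0 ab; rewrite -powRM// ge0_ler_powR// nnegrE//.
exact: mulr_ge0.
Qed.

(** Either |s| <= 2 |s - t|, or |t| exceeds |s| / 2 > L / 2; each case feeds one summand. *)
Lemma tailpow_split L (s t : R) : 0 <= L ->
  tailpow L `|s| <= 2 `^ p * `|s - t| `^ p + 2 `^ p * tailpow (L / 2) `|t|.
Proof.
move=> L0; have [Ls|sL] := ltP L `|s|; last first.
  rewrite {1}/tailpow ltNge sL mul0r addr_ge0// mulr_ge0 ?powR_ge0//.
  exact: tailpow_ge0.
rewrite tailpow_gt//.
have st : `|s| <= `|s - t| + `|t| by rewrite -[in leLHS](subrK t s) ler_normD.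
have [h|h] := leP `|s| (2 * `|s - t|).
  apply: le_trans (powR_le_scale _ _ _ h) _ => //.
  by rewrite lerDl mulr_ge0 ?powR_ge0// tailpow_ge0.
rewrite tailpow_gt; last by lra.
apply: (@le_trans _ _ (2 `^ p * `|t| `^ p)); first by apply: powR_le_scale => //; lra.
by rewrite lerDr mulr_ge0 ?powR_ge0.
Qed.

Lemma tailpow_ge1 L a : 1 <= L -> L < a -> 1 <= tailpow L a.
Proof.
move=> L1 La; rewrite tailpow_gt//; apply: (@le_trans _ _ (1 `^ p)); first by rewrite powR1.
by rewrite ge0_ler_powR ?nnegrE//; lra.
Qed.

(** For a > eta, multiply [a] by (a / eta)^(p-1) >= 1. This converts Lipschitz errors, linear in the
    displacement, into p-th power costs. *)
Lemma le_eta_pow (a eta : R) : 0 <= a -> 0 < eta -> a <= eta + a `^ p / eta `^ (p - 1).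
Proof.
move=> a0 eta0; have [ae|ea] := leP a eta.
  by rewrite ler_wpDr// divr_ge0// powR_ge0.
rewrite ler_wpDl ?(ltW eta0)// ler_pdivlMr ?powR_gt0//.
rewrite -(mulr_powRB1 a0 p_gt0) ler_wpM2l//.
by rewrite ge0_ler_powR ?nnegrE ?subr_ge0 ?(ltW eta0)// ltW.
Qed.

End Tails.

(** * Estimates along slices *)

Section SliceSelection.
Context (R : realType) (d : nat) (p : R) (d0 : (0 < d)%N) (p1 : 1 <= p).
Variables (mus : nat -> probability (d.-tuple R) R) (mu : probability (d.-tuple R) R).

Let p_gt0 : 0 < p. Proof. exact: lt_le_trans p1. Qed.

(* The slice cost is not known to be measurable in the direction, but a
   positive lower bound on a cap is visible to the lower integral. *)
Lemma SW_select (th0 : d.-tuple R) (r : R) :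
  converges_under (SW p) mus mu -> normv th0 = 1 -> 0 < r ->
  \forall n \near \oo, exists th, [/\ normv th = 1, distv th th0 < r &
    exists pi, coupling (radon (mus n) th) (radon mu th) pi /\
      (\int[pi]_z (`|z.1 - z.2| `^ p)%:E < r%:E)%E].
Proof.
move=> /cvge0P H th01 r0; have {}H := H (fun n => poweR_ge0 _ _).
have := unif_sphere_cap d0 th01 r0; set A := [set th | _] => A0.
have mA : measurable A.
  apply: measurableI; first exact: measurable_sphere.
  rewrite -[X in measurable X]setTI; rewrite (_ : (fun x => _) = (fun x => distv x th0) @^-1` `]-oo, r[).
    by apply: measurable_distvl.
  by apply/funext => x /=; rewrite in_itv.
have [s s0 sA] : exists2 s : R, 0 < s & (s%:E <= unif_sphere A)%E.
  case: (unif_sphere A) A0 => [s| |]//; first by rewrite lte_fin => s0; exists s.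
  by move=> _; exists 1 => //; rewrite leey.
(* If every direction of the cap [A] had slice cost at least [r], Markov's inequality would force
   SW^p >= r s, twice what this threshold allows. *)
have e0 : 0 < (r * s / 2) `^ p^-1 by rewrite powR_gt0// divr_gt0// mulr_gt0.
near=> n.
have Hn : (SW p (mus n) mu <= ((r * s / 2) `^ p^-1)%:E)%E by near: n; exact: H.
apply: contrapT => no.
have : (r%:E * unif_sphere A <= \int[@unif_sphere R d]_th
    ((Wp1 p (radon (mus n) th) (radon mu th)) `^ p))%E.
  apply: raw_integral_ge => [|x|||th [th1 thr]].
  - exact: unif_sphere0.
  - exact: poweR_ge0.
  - exact: mA.
  - exact: ltW.
  - rewrite leNgt; apply/negP => /(Wasserstein_lt p1)[pi [cpl pir]].
    by apply: no; exists th; split => //; exists pi.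
apply/negP; rewrite -ltNge.
have : (SW p (mus n) mu `^ p <= (r * s / 2)%:E)%E.
  rewrite -[leRHS](poweRVK p1); last by rewrite lee_fin ltW// divr_gt0// mulr_gt0.
  by apply: le_poweR => //; [exact: ltW|exact: poweR_ge0].
rewrite poweRVK//; last first.
  by apply: raw_integral_ge0 => [|x]; [exact: unif_sphere0|exact: poweR_ge0].
move=> /le_lt_trans; apply.
apply: (@lt_le_trans _ _ (r * s)%:E); last by rewrite EFinM lee_pmul2l// lte_fin.
by rewrite lte_fin ltr_pdivrMr// ltr_pMr ?mulr_gt0// ltr1n.
Unshelve. all: by end_near. Qed.

End SliceSelection.

Section SliceEstimates.
Context (R : realType) (d : nat) (p : R) (d0 : (0 < d)%N) (p1 : 1 <= p).
Implicit Types (P Q : probability (d.-tuple R) R) (th : d.-tuple R).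

Let p_gt0 : 0 < p. Proof. exact: lt_le_trans p1. Qed.

Definition tail P (L : R) : \bar R := (\int[P]_x (tailpow p L (normv x))%:E)%E.

Lemma tail_ge0 P L : (0 <= tail P L)%E.
Proof. by apply: integral_ge0 => x _; rewrite lee_fin tailpow_ge0. Qed.

Lemma tail_anti P L L' : L <= L' -> (tail P L' <= tail P L)%E.
Proof.
move=> LL'; apply: le_raw_integral => [|x|x]; first by rewrite measure0.
  by rewrite lee_fin tailpow_ge0.
by rewrite lee_fin tailpow_anti.
Qed.

Lemma tail_small P (e : R) : finite_moment p P -> 0 < e ->
  exists2 L, 1 <= L & (tail P L <= e%:E)%E.
Proof.
move=> Pp e0.
have mn : measurable_fun setT (fun x : d.-tuple R => normv x `^ p).
  by apply: (measurableT_comp (measurable_powR p)); exact: measurable_normv.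
have [] := @dominated_convergence _ _ R P setT measurableT
   (fun n x => (tailpow p n.+1%:R (normv x))%:E) (cst 0%E)
   (fun x => (normv x `^ p)%:E).
- by move=> n; apply/measurable_EFinP; apply: measurable_tailpow; exact: measurable_normv.
- exact: measurable_cst.
- apply: aeW => x _; apply: cvg_near_cst.
  exists (Num.trunc (normv x)) => // n /= xn.
  rewrite /tailpow ltNge (_ : normv x <= _) ?mul0r//.
  have := truncnS_gt (normv x); move/ltW/le_trans; apply.
  by rewrite ler_nat ltnS.
- apply/integrableP; split; first exact/measurable_EFinP.
  apply: le_lt_trans Pp; rewrite le_eqVlt; apply/orP; left; apply/eqP.
  by apply: eq_integral => x _; rewrite gee0_abs// lee_fin powR_ge0.
- apply: aeW => x n _; rewrite gee0_abs ?lee_fin ?tailpow_ge0//.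
  exact: tailpow_le.
move=> _ _; rewrite integral_cst// mul0e => /cvge0P H.
have {}H := H (fun n => tail_ge0 P n.+1%:R) e e0.
by have [N _ HN] := H; exists N.+1%:R; [rewrite ler1n|exact: (HN N (leqnn N))].
Qed.

Section Coupled.
Variables (P Q : probability (d.-tuple R) R) (th : d.-tuple R) (r : R).
Hypotheses (th1 : normv th = 1).
Variable pi : probability (R * R)%type R.
Hypotheses (cpl : coupling (radon P th) (radon Q th) pi)
  (cost : (\int[pi]_z (`|z.1 - z.2| `^ p)%:E <= r%:E)%E).

Let mth : measurable_fun setT (fun x : d.-tuple R => dotv x th).
Proof. exact: measurable_dotvl. Qed.

Let mcost : measurable_fun setT (fun z : R * R => (`|z.1 - z.2| `^ p)%:E).
Proof.
apply/measurable_EFinP; apply: (measurableT_comp (measurable_powR p)).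
apply: measurableT_comp => //; exact: measurable_funB.
Qed.

(** The easy half of Kantorovich duality: the pointwise bound is integrated against the coupling
    [pi]. *)
Lemma slice_compare (F G : R -> R) (k : R) :
  measurable_fun setT F -> measurable_fun setT G -> 0 <= k ->
  (forall s, 0 <= F s) -> (forall s, 0 <= G s) ->
  (forall s t, F s <= k * `|s - t| `^ p + G t) ->
  (\int[P]_x (F (dotv x th))%:E <= (k * r)%:E + \int[Q]_x (G (dotv x th))%:E)%E.
Proof.
move=> mF mG k0 F0 G0 FG.
have [<- _] := coupling_integral mth cpl (F := EFin \o F)
  ((measurable_EFinP _ _).2 mF) (fun s => F0 s).
have [_ <-] := coupling_integral mth cpl (F := EFin \o G)
  ((measurable_EFinP _ _).2 mG) (fun s => G0 s).
apply: (@le_trans _ _ (\int[pi]_z (k%:E * (`|z.1 - z.2| `^ p)%:E + (G z.2)%:E))%E).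
  apply: le_raw_integral => [|z|z]; first by rewrite measure0.
    by rewrite lee_fin.
  by rewrite -EFinM -EFinD lee_fin.
rewrite ge0_integralD; last 5 first.
- exact: measurableT.
- by move=> z _; rewrite -EFinM lee_fin mulr_ge0// powR_ge0.
- exact: measurable_funeM.
- by move=> z _; rewrite lee_fin.
- by apply/measurable_EFinP; exact: (measurableT_comp mG measurable_snd).
rewrite leeD2r// ge0_integralZl_EFin; last 4 first.
- exact: measurableT.
- by move=> z _; rewrite lee_fin powR_ge0.
- exact: mcost.
- exact: k0.
by rewrite EFinM lee_wpmul2l// lee_fin.
Qed.

Lemma slice_tail L : 0 <= L ->
  (\int[P]_x (tailpow p L `|dotv x th|)%:E <= (2 `^ p)%:E * (r%:E + tail Q (L / 2)))%E.
Proof.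
move=> L0.
have mt L' : measurable_fun setT (fun s : R => tailpow p L' `|s|).
  exact: measurable_tailpow.
have H := @slice_compare (fun s => tailpow p L `|s|)
  (fun s => 2 `^ p * tailpow p (L / 2) `|s|) (2 `^ p) (mt L) (measurable_funM (measurable_cst _) (mt _))
  (powR_ge0 _ _) (fun s => tailpow_ge0 _ _ _)
  (fun s => mulr_ge0 (powR_ge0 _ _) (tailpow_ge0 _ _ _)) (fun s t => tailpow_split p1 s t L0).
have r0 : (0 <= r%:E)%E.
  by apply: le_trans cost; apply: integral_ge0 => z _; rewrite lee_fin powR_ge0.
apply: le_trans H _; rewrite ge0_muleDr ?tail_ge0//.
rewrite EFinM leeD2l//; under eq_integral do rewrite EFinM.
rewrite ge0_integralZl_EFin; last 4 first.
- exact: measurableT.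
- by move=> x _; rewrite lee_fin tailpow_ge0.
- by apply/measurable_EFinP; exact: (measurableT_comp (mt _) mth).
- exact: powR_ge0.
rewrite lee_wpmul2l ?lee_fin ?powR_ge0//.
apply: le_raw_integral => [|x|x]; first by rewrite measure0.
  by rewrite lee_fin tailpow_ge0.
rewrite lee_fin tailpow_mono//; apply: le_trans (normr_dotv_le _ _) _.
by rewrite th1 mulr1.
Qed.

(** The map s |-> cos (t s + b) is |t|-Lipschitz, and [le_eta_pow] trades |s - s'| for its p-th
    power. Adding 1 keeps the integrands nonnegative. *)
Lemma slice_cos (t b eta : R) : 0 < eta ->
  (\int[P]_x (1 + cos (t * dotv x th + b))%:E <=
   \int[Q]_x (1 + cos (t * dotv x th + b))%:E
     + (`|t| * (eta + r / eta `^ (p - 1)))%:E)%E.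
Proof.
move=> eta0.
have mc : measurable_fun setT (fun s : R => 1 + cos (t * s + b)).
  apply: continuous_measurable_fun => s; apply: cvgD; first exact: cvg_cst.
  apply: (@cvg_comp _ _ _ (fun s => t * s + b) cos _ (nbhs (t * s + b))).
    by apply: cvgD; [apply: cvgM; [exact: cvg_cst|exact: cvg_id]|exact: cvg_cst].
  exact: continuous_cos.
have c0 s : 0 <= 1 + cos (t * s + b) by have := cos_geN1 (t * s + b); lra.
have te0 : 0 <= `|t| * eta by rewrite mulr_ge0// ltW.
have H := @slice_compare (fun s => 1 + cos (t * s + b))
  (fun s => 1 + cos (t * s + b) + `|t| * eta) (`|t| / eta `^ (p - 1)) mc
  (measurable_funD mc (measurable_cst _)) (divr_ge0 (normr_ge0 _) (powR_ge0 _ _))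
  c0 (fun s => addr_ge0 (c0 s) te0).
apply: (le_trans (H _)) => [s s'|].
  have := le_trans (ler_norm _) (cos_lipschitz (t * s + b) (t * s' + b)).
  rewrite opprD addrACA subrr addr0 -mulrBr normrM.
  have := ler_wpM2l (normr_ge0 t) (le_eta_pow p1 (normr_ge0 (s - s')) eta0).
  rewrite mulrDr mulrCA mulrC -mulrA; lra.
under [X in (_ + X <= _)%E]eq_integral do rewrite EFinD.
rewrite ge0_integralD; last 5 first.
- exact: measurableT.
- by move=> z _; rewrite lee_fin.
- by apply/measurable_EFinP; exact: (measurableT_comp mc mth).
- by move=> z _; rewrite lee_fin.
- exact: measurable_cst.
rewrite integral_cst// [X in (_ * X)%E](_ : _ = 1%E) ?mule1; last exact: probability_setT.
rewrite addeCA leeD2l// -EFinD lee_fin; lra.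
Qed.

End Coupled.

(** Some coordinate of [x] is at least |x| / d in size, and replacing e_i by a direction within 1 /
    (2d) loses at most half of that. *)
Lemma tailpow_directions (th : 'I_d -> d.-tuple R) (x : d.-tuple R) (L : R) : 0 <= L ->
  (forall i, distv (th i) [tuple (i == j)%:R | j < d] < (2 * d%:R)^-1) ->
  tailpow p L (normv x) <= (2 * d%:R) `^ p *
    \sum_i tailpow p (L / (2 * d%:R)) `|dotv x (th i)|.
Proof.
move=> L0 thi; have D0 : 0 < d%:R :> R by rewrite ltr0n.
have DD0 : 0 < 2 * d%:R :> R by rewrite mulr_gt0.
have sum0 (Q : pred 'I_d) : 0 <= \sum_(i | Q i) tailpow p (L / (2 * d%:R)) `|dotv x (th i)|.
  by apply: sumr_ge0 => i _; exact: tailpow_ge0.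
have [Lx|xL] := ltP L (normv x); last first.
  by rewrite {1}/tailpow ltNge xL mul0r mulr_ge0 ?powR_ge0.
have [i xi] : exists i, normv x / d%:R <= `|tnth x i|.
  apply/not_existsP => H.
  have : normv x < \sum_(i < d) normv x / d%:R.
    apply: le_lt_trans (normv_le_sum x) _; apply: ltr_sum.
      by apply/hasP; exists (Ordinal d0) => //; exact: mem_index_enum.
    by move=> i _; rewrite ltNge; exact/negP/H.
  by rewrite sumr_const card_ord -[(_ / _ *+ _)]mulr_natr divfK ?ltxx// gt_eqF.
have xth : normv x / (2 * d%:R) <= `|dotv x (th i)|.
  have E : dotv [tuple (i == j)%:R | j < d] x = tnth x i.
    rewrite /dotv (bigD1 i)//= tnth_mktuple eqxx mul1r big1 ?addr0// => j ji.
    by rewrite tnth_mktuple eq_sym (negbTE ji) mul0r.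
  have := dotvB_le (th i) [tuple (i == j)%:R | j < d] x.
  rewrite E (dotvC (th i)) => h.
  have h2 : distv (th i) [tuple (i == j)%:R | j < d] * normv x <= normv x / (2 * d%:R).
    by rewrite [leRHS]mulrC ler_wpM2r ?normv_ge0// ltW.
  have h3 : `|tnth x i| <= `|dotv x (th i)| + `|dotv x (th i) - tnth x i|.
    by rewrite -[in leLHS](subKr (dotv x (th i)) (tnth x i)) ler_normB.
  have : normv x / d%:R = normv x / (2 * d%:R) + normv x / (2 * d%:R).
    by field; rewrite gt_eqF.
  lra.
rewrite tailpow_gt//; apply: (@le_trans _ _ ((2 * d%:R) `^ p * `|dotv x (th i)| `^ p)).
  apply: powR_le_scale => //; rewrite ?normv_ge0 ?(ltW DD0)//.
  by rewrite mulrC -ler_pdivrMr.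
rewrite ler_wpM2l ?powR_ge0// (bigD1 i)//= tailpow_gt.
  by rewrite lerDl.
by apply: lt_le_trans xth; rewrite ltr_pM2r// invr_gt0.
Qed.

(** Inside the ball of radius [L] the phases differ by at most |t| L |th - th0|. Outside, 1 + cos is
    at most 2, while [tailpow] is at least 1 because L >= 1. *)
Lemma tail_cos P th th0 (t b L : R) : 1 <= L ->
  (\int[P]_x (1 + cos (t * dotv x th + b))%:E <=
   \int[P]_x (1 + cos (t * dotv x th0 + b))%:E
     + ((`|t| * L * distv th th0)%:E + 2%:E * tail P L))%E.
Proof.
move=> L1.
have mc th' : measurable_fun setT (fun x : d.-tuple R => 1 + cos (t * dotv x th' + b)).
  apply: measurable_funD => //; apply: (measurableT_comp (continuous_measurable_fun (@continuous_cos R))).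
  by apply: measurable_funD => //; apply: measurable_funM => //; exact: measurable_dotvl.
have c0 s : 0 <= 1 + cos s :> R by have := cos_geN1 s; lra.
have tL0 : 0 <= `|t| * L * distv th th0.
  by rewrite !mulr_ge0// ?distv_ge0//; lra.
have mtl : measurable_fun setT (fun x : d.-tuple R => (tailpow p L (normv x))%:E).
  by apply/measurable_EFinP; apply: measurable_tailpow; exact: measurable_normv.
apply: (@le_trans _ _ (\int[P]_x ((1 + cos (t * dotv x th0 + b))%:E +
   ((`|t| * L * distv th th0)%:E + 2%:E * (tailpow p L (normv x))%:E)))%E).
  apply: le_raw_integral => [|x|x]; first by rewrite measure0.
    by rewrite lee_fin.
  rewrite -EFinM -!EFinD lee_fin; have [Lx|xL] := ltP L (normv x).
    have := tailpow_ge1 p1 L1 Lx; have := cos_le1 (t * dotv x th + b).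
    have := cos_geN1 (t * dotv x th0 + b); lra.
  have := le_trans (ler_norm _) (cos_lipschitz (t * dotv x th + b) (t * dotv x th0 + b)).
  rewrite opprD addrACA subrr addr0 -mulrBr normrM.
  have h1 : `|dotv x th - dotv x th0| <= L * distv th th0.
    rewrite !(dotvC x); apply: le_trans (dotvB_le _ _ _) _.
    by rewrite mulrC ler_wpM2r// distv_ge0.
  have := ler_wpM2l (normr_ge0 t) h1; rewrite mulrA.
  have := tailpow_ge0 p L (normv x); lra.
rewrite ge0_integralD; last 5 first.
- exact: measurableT.
- by move=> z _; rewrite lee_fin.
- exact/measurable_EFinP.
- by move=> z _; rewrite -EFinM -EFinD lee_fin addr_ge0// mulr_ge0// tailpow_ge0.
- by apply: emeasurable_funD => //; exact: measurable_funeM.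
rewrite leeD2l// ge0_integralD; last 5 first.
- exact: measurableT.
- by move=> z _; rewrite lee_fin.
- exact: measurable_cst.
- by move=> z _; rewrite -EFinM lee_fin mulr_ge0// tailpow_ge0.
- exact: measurable_funeM.
rewrite integral_cst// [X in (_ * X)%E](_ : _ = 1%E) ?mule1; last exact: probability_setT.
rewrite leeD2l// ge0_integralZl_EFin//.
by move=> x _; rewrite lee_fin tailpow_ge0.
Qed.

End SliceEstimates.

(** * Sliced convergence: uniform tails and convergence of cosine integrals *)

Section FromSlices.
Context (R : realType) (d : nat) (p : R) (d0 : (0 < d)%N) (p1 : 1 <= p).
Variables (mus : nat -> probability (d.-tuple R) R) (mu : probability (d.-tuple R) R).
Hypotheses (Hsw : converges_under (SW p) mus mu) (pmu : finite_moment p mu).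

(** Large points of mu_n are seen by one of [d] slices near the axes, and there the coupling
    compares them with the tail of [mu], small by dominated convergence. *)
Lemma tail_uniform (e : R) : 0 < e -> exists L, [/\ 1 <= L,
  (tail p mu L <= e%:E)%E & \forall n \near \oo, (tail p (mus n) L <= e%:E)%E].
Proof.
move=> e0; pose D : R := 2 * d%:R; pose K : R := D `^ p * d%:R * 2 `^ p.
have dR : 1 <= d%:R :> R by rewrite ler1n.
have D1 : 1 <= D by rewrite /D; lra.
have D0 : 0 < D by exact: lt_le_trans D1.
have K0 : 0 < K by rewrite !mulr_gt0 ?powR_gt0//; exact: lt_le_trans dR.
pose eta := Num.min e (e / (2 * K)).
have eta0 : 0 < eta by rewrite lt_min e0 divr_gt0// mulr_gt0.
have Keta : K * (eta + eta) <= e.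
  have : eta <= e / (2 * K) by rewrite ge_min lexx orbT.
  rewrite ler_pdivlMr; last exact: mulr_gt0.
  by move=> h; apply: le_trans h; rewrite le_eqVlt; apply/orP; left; apply/eqP; ring.
have [L0 L01 tL0] := tail_small pmu eta0.
(* [tailpow_directions] divides the cut by D = 2d and [slice_tail] halves it again, which lands on
   [L0]. Their factors, over [d] directions, make up [K]. *)
pose L := L0 * (2 * D).
have LL0 : L0 <= L by rewrite /L; nra.
exists L; split; first exact: le_trans LL0.
  apply: le_trans (tail_anti p mu LL0) _; apply: le_trans tL0 _.
  by rewrite lee_fin ge_min lexx.
have r0 : 0 < Num.min eta D^-1 by rewrite lt_min eta0 invr_gt0.
pose e_ (i : 'I_d) : d.-tuple R := [tuple (i == j)%:R | j < d].
have e1 i : normv (e_ i) = 1.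
  rewrite /normv (_ : dotv _ _ = 1) ?sqrtr1// /dotv (bigD1 i)//= !tnth_mktuple eqxx mulr1.
  rewrite big1 ?addr0// => j ji; by rewrite tnth_mktuple eq_sym (negbTE ji) mul0r.
near=> n.
have Hn : forall i, exists th, [/\ normv th = 1, distv th (e_ i) < Num.min eta D^-1 &
    exists pi, coupling (radon (mus n) th) (radon mu th) pi /\
      (\int[pi]_z (`|z.1 - z.2| `^ p)%:E < (Num.min eta D^-1)%:E)%E].
  by near: n; apply: filter_forall => i; exact: SW_select.
have {Hn} [th Hth] := choice Hn.
have thD i : distv (th i) (e_ i) < D^-1.
  by have [_ h _] := Hth i; apply: lt_le_trans h _; rewrite ge_min lexx orbT.
have L_ge0 : 0 <= L by apply: le_trans LL0; lra.
have LD_ge0 : 0 <= L / D by rewrite divr_ge0// ltW.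
have mt i : measurable_fun setT (fun x => (tailpow p (L / D) `|dotv x (th i)|)%:E).
  apply/measurable_EFinP; apply: measurable_tailpow.
  by apply: measurableT_comp => //; exact: measurable_dotvl.
have H1 : (tail p (mus n) L <= (D `^ p)%:E *
    \sum_i \int[mus n]_x (tailpow p (L / D) `|dotv x (th i)|)%:E)%E.
  rewrite -ge0_integral_sum//; last by move=> i x _; rewrite lee_fin tailpow_ge0.
  rewrite -ge0_integralZl_EFin; last 4 first.
  - exact: measurableT.
  - by move=> x _; apply: sume_ge0 => i _; rewrite lee_fin tailpow_ge0.
  - by apply: emeasurable_sum.
  - exact: powR_ge0.
  apply: le_raw_integral => [|x|x]; first by rewrite measure0.
    by rewrite lee_fin tailpow_ge0.
  by rewrite sumEFin -EFinM lee_fin; exact: tailpow_directions.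
apply: le_trans H1 _.
have H2 i : (\int[mus n]_x (tailpow p (L / D) `|dotv x (th i)|)%:E <=
    (2 `^ p * (eta + eta))%:E)%E.
  have [h1 _ [pi [cpl cost]]] := Hth i.
  apply: le_trans (slice_tail p1 h1 cpl (ltW cost) LD_ge0) _.
  rewrite EFinM lee_wpmul2l ?lee_fin ?powR_ge0// EFinD leeD//.
    by rewrite lee_fin ge_min lexx.
  suff -> : L / D / 2 = L0 by exact: tL0.
  by rewrite /L; field; rewrite gt_eqF.
apply: (@le_trans _ _ ((D `^ p)%:E * \sum_(i < d) (2 `^ p * (eta + eta))%:E)%E).
  rewrite lee_wpmul2l ?lee_fin ?powR_ge0//.
  by apply: lee_sum => i _; exact: H2.
rewrite sumEFin -EFinM lee_fin sumr_const card_ord -[(_ * _ *+ _)]mulr_natl.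
by move: Keta; rewrite /K; lra.
Unshelve. all: by end_near. Qed.

Let cosint (P : probability (d.-tuple R) R) (t : R) th b : R := \int[P]_x cos (t * dotv x th + b).

Let mcos (t b : R) (th : d.-tuple R) :
  measurable_fun setT (fun x : d.-tuple R => cos (t * dotv x th + b)).
Proof.
apply: (measurableT_comp (continuous_measurable_fun (@continuous_cos R))).
by apply: measurable_funD => //; apply: measurable_funM => //; exact: measurable_dotvl.
Qed.

Let cosintE (P : probability (d.-tuple R) R) t th b :
  (\int[P]_x (1 + cos (t * dotv x th + b))%:E)%E = (1 + cosint P t th b)%:E.
Proof.
have := @integral_affine _ _ R P 'I_1 (fun _ x => cos (t * dotv x th + b)) 1 1 (fun=> 1)
  (fun=> mcos t b th) (fun _ _ => cos_max _).
rewrite big_ord1 mul1r => <-; apply: eq_integral => x _.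
by rewrite big_ord1 mul1r.
Qed.

(** Three moves: from [th0] to a good direction [th] under mu_n, from mu_n to [mu] along [th], and
    back to [th0] under [mu]. The tails cost e/6 twice, [eta] costs e/6, and all terms containing
    [r] together at most e/6. Taking s = |t| + 1 avoids dividing by zero. *)
Let cosint_le (t : R) th0 b (e : R) : normv th0 = 1 -> 0 < e ->
  \forall n \near \oo, cosint (mus n) t th0 b <= cosint mu t th0 b + e.
Proof.
move=> th01 e0; have e12 : 0 < e / 12 by rewrite divr_gt0.
have [L [L1 tmu tn]] := tail_uniform e12.
pose s := `|t| + 1; have s0 : 0 < s by rewrite ltr_wpDl.
pose eta := e / (6 * s); have eta0 : 0 < eta by rewrite divr_gt0// mulr_gt0.
pose X := L + (eta `^ (p - 1))^-1.
have X0 : 0 < X by rewrite addr_gt0 ?invr_gt0 ?powR_gt0//; lra.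
pose r := e / (12 * s * X).
have r0 : 0 < r by rewrite divr_gt0// !mulr_gt0.
have seta : s * eta = e / 6 by rewrite /eta; field; rewrite gt_eqF.
have srX : s * r * X = e / 12 by rewrite /r; field; rewrite !gt_eqF.
have t0 := normr_ge0 t.
have Xdef : X = L + (eta `^ (p - 1))^-1 by [].
have Y0 : 0 <= (eta `^ (p - 1))^-1 by rewrite invr_ge0 powR_ge0.
clearbody eta r X.
near=> n.
have tnn : (tail p (mus n) L <= (e / 12)%:E)%E by near: n.
have : exists th, [/\ normv th = 1, distv th th0 < r &
    exists pi, coupling (radon (mus n) th) (radon mu th) pi /\
      (\int[pi]_z (`|z.1 - z.2| `^ p)%:E < r%:E)%E].
  by near: n; exact: SW_select.
move=> [th [th1 thr [pi [cpl /ltW cost]]]].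
have H1 := tail_cos p1 (mus n) th0 th t b L1.
have H2 := slice_cos p1 cpl cost t b eta0.
have H3 := tail_cos p1 mu th th0 t b L1.
have T2 (P : probability (d.-tuple R) R) : (tail p P L <= (e / 12)%:E)%E -> (2%:E * tail p P L <= (e / 6)%:E)%E.
  move=> h; have -> : (e / 6)%:E = (2%:E * (e / 12)%:E)%E :> \bar R.
    by rewrite -EFinM; congr (_%:E); field.
  by rewrite lee_wpmul2l.
have := le_trans H1 (leeD2l _ (leeD2l _ (T2 _ tnn))).
have := le_trans H3 (leeD2l _ (leeD2l _ (T2 _ tmu))).
move: H2; rewrite !cosintE -!EFinD !lee_fin (distvC th0 th).
have tr : `|t| * L * distv th th0 <= `|t| * L * r.
  by rewrite ler_wpM2l ?mulr_ge0// ?(ltW thr)//; lra.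
have : `|t| * eta <= e / 6 by rewrite -seta /s mulrDl mul1r; lra.
have : `|t| * r * X <= e / 12.
  by rewrite -srX /s !mulrDl mul1r lerDl mulr_ge0// ltW.
have : 0 <= `|t| * r * L by rewrite !mulr_ge0// ?(ltW r0)//; lra.
have : 0 <= `|t| * r * (eta `^ (p - 1))^-1 by rewrite !mulr_ge0// ltW.
rewrite Xdef; lra.
Unshelve. all: by end_near. Qed.

(** Shifting the phase by pi negates the cosine, so the upper bound [cosint_le] also yields the
    lower bound. *)
Let cosintDpi (P : probability (d.-tuple R) R) t th b :
  cosint P t th (b + pi) = - cosint P t th b.
Proof.
have := cosintE P t th b.
have := @integral_affine _ _ R P 'I_1 (fun _ x => cos (t * dotv x th + b)) 1 1 (fun=> -1)
  (fun=> mcos t b th) (fun _ _ => cos_max _).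
rewrite big_ord1 => H _; have := cosintE P t th (b + pi).
rewrite (eq_integral (fun x => (1 + \sum_(i < 1) -1 * cos (t * dotv x th + b))%:E)).
  by rewrite H => -[]; rewrite /cosint; lra.
by move=> x _; rewrite big_ord1 addrA cosDpi mulN1r.
Qed.

(** Characteristic functions in real form: the phase [b] covers the real and the imaginary part. *)
Lemma cos_integral_cvg (xi : d.-tuple R) (b : R) :
  \int[mus n]_x cos (dotv x xi + b) @[n --> \oo] --> \int[mu]_x cos (dotv x xi + b).
Proof.
have key (t : R) th0 : normv th0 = 1 ->
    cosint (mus n) t th0 b @[n --> \oo] --> cosint mu t th0 b.
  move=> th01; apply/cvgrPdist_le => e e0; near=> n.
  have h1 : cosint (mus n) t th0 b <= cosint mu t th0 b + e.
    by near: n; exact: cosint_le.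
  have : cosint (mus n) t th0 (b + pi) <= cosint mu t th0 (b + pi) + e.
    by near: n; exact: cosint_le.
  rewrite !cosintDpi => h2.
  by rewrite ler_norml; apply/andP; split; lra.
have [xi0|xi0] := eqVneq (normv xi) 0.
  pose e1 : d.-tuple R := [tuple (Ordinal d0 == j)%:R | j < d].
  have := key 0 e1; rewrite /cosint.
  suff E (x : d.-tuple R) : dotv x xi = 0 * dotv x e1.
    have -> : (fun x : d.-tuple R => cos (dotv x xi + b)) =
       (fun x => cos (0 * dotv x e1 + b)) by apply/funext => x; rewrite E.
    apply; rewrite /normv (_ : dotv _ _ = 1) ?sqrtr1// /dotv (bigD1 (Ordinal d0))//=.
    rewrite !tnth_mktuple eqxx mulr1.
    by rewrite big1 ?addr0// => j ji; rewrite tnth_mktuple eq_sym (negbTE ji) mul0r.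
  rewrite mul0r; apply/eqP; rewrite -normr_le0; apply: le_trans (normr_dotv_le _ _) _.
  by rewrite xi0 mulr0.
have xi_gt0 : 0 < normv xi by rewrite lt_def xi0 normv_ge0.
have := key (normv xi) (normalize xi) (normv_normalize xi_gt0); rewrite /cosint.
have E (x : d.-tuple R) : normv xi * dotv x (normalize xi) = dotv x xi.
  rewrite /dotv mulr_sumr; apply: eq_bigr => i _; rewrite tnth_map; field.
  exact: xi0.
suff -> : (fun x : d.-tuple R => cos (normv xi * dotv x (normalize xi) + b)) =
   (fun x => cos (dotv x xi + b)) by [].
by apply/funext => x; rewrite E.
Unshelve. all: by end_near. Qed.

End FromSlices.

(** * Cells of a partition of unity *)

Section Bernstein.
Context (R : realType).
Implicit Types (u c : R) (K m : nat).

(* Binomial weights, through the recursion for one more Bernoulli trial. *)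
Fixpoint bern u K m : R := match K with
  | 0 => (m == 0%N)%:R
  | K'.+1 => (1 - u) * bern u K' m + u * (if m is m'.+1 then bern u K' m' else 0)
  end.

Lemma bern_ge0 u K m : 0 <= u <= 1 -> 0 <= bern u K m.
Proof.
move=> /andP[u0 u1]; elim: K m => [|K IH] m /=; first exact: ler0n.
apply: addr_ge0; apply: mulr_ge0 => //; first by rewrite subr_ge0.
by case: m.
Qed.

Lemma bern_big u K m : (K < m)%N -> bern u K m = 0.
Proof.
elim: K m => [|K IH] [|m]//= Km; first by rewrite !IH ?mulr0 ?addr0// ltnW.
Qed.

(** Expectation of f over [K.+1] trials, conditioned on the outcome of one of them. *)
Lemma bern_sumS u K (f : nat -> R) :
  \sum_(m < K.+2) bern u K.+1 m * f m =
  (1 - u) * (\sum_(m < K.+1) bern u K m * f m) +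
  u * \sum_(m < K.+1) bern u K m * f m.+1.
Proof.
rewrite (eq_bigr (fun m : 'I_K.+2 => (1 - u) * (bern u K m * f m) +
   u * ((if nat_of_ord m is m'.+1 then bern u K m' else 0) * f m))); last first.
  by move=> m _ /=; ring.
rewrite big_split/= -!mulr_sumr; congr (_ * _ + _ * _).
  by rewrite big_ord_recr/= bern_big// mul0r addr0.
by rewrite big_ord_recl/= mul0r add0r.
Qed.

Lemma bern_sum1 u K : \sum_(m < K.+1) bern u K m = 1.
Proof.
elim: K => [|K IH]; first by rewrite big_ord1.
have := bern_sumS u K (fun=> 1); under eq_bigr do rewrite mulr1.
move=> ->; under eq_bigr do rewrite mulr1; rewrite IH; ring.
Qed.

(** Variance plus squared bias of a binomial variable. The centre [c] is arbitrary because a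
    successful trial shifts it to c - 1 in the induction. *)
Lemma bern_var u K c : \sum_(m < K.+1) bern u K m * (m%:R - c) ^+ 2 =
  K%:R * u * (1 - u) + (K%:R * u - c) ^+ 2.
Proof.
elim: K c => [|K IH] c; first by rewrite big_ord1 /=; ring.
rewrite (bern_sumS u K (fun m => (m%:R - c) ^+ 2)) IH.
rewrite (eq_bigr (fun m : 'I_K.+1 => bern u K m * (m%:R - (c - 1)) ^+ 2)).
  by rewrite IH -natr1; ring.
by move=> m _; rewrite -natr1; ring.
Qed.

Context (d K : nat) (u : 'I_d -> R) (u01 : forall j, 0 <= u j <= 1).

Definition cellw (i : {ffun 'I_d -> 'I_K.+1}) : R := \prod_j bern (u j) K (i j).

Lemma cellw_ge0 i : 0 <= cellw i.
Proof. by apply: prodr_ge0 => j _; exact: bern_ge0. Qed.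

Lemma cellw_sum1 : \sum_i cellw i = 1.
Proof.
rewrite /cellw -(bigA_distr_bigA (fun j (m : 'I_K.+1) => bern (u j) K m)).
by apply: big1 => j _; exact: bern_sum1.
Qed.

Lemma cellw_var : (0 < K)%N ->
  \sum_i cellw i * (\sum_j (u j - (i j)%:R / K%:R) ^+ 2) <= d%:R / K%:R.
Proof.
move=> K0; have K0' : 0 < K%:R :> R by rewrite ltr0n.
under eq_bigr do rewrite mulr_sumr.
rewrite exchange_big/=.
apply: (@le_trans _ _ (\sum_(j < d) K%:R^-1)); last first.
  by rewrite sumr_const card_ord -[leLHS]mulr_natl.
apply: ler_sum => j _.
(* The squared deviation is absorbed into the factor of coordinate [j], so the sum over cells
   factorizes and every other factor sums to 1. *)
pose F l (m : 'I_K.+1) := bern (u l) K m *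
  (if l == j then (u j - m%:R / K%:R) ^+ 2 else 1).
rewrite (eq_bigr (fun i : {ffun 'I_d -> 'I_K.+1} => \prod_l F l (i l))); last first.
  move=> i _; rewrite /F big_split/=; congr (_ * _).
  by rewrite (bigD1 j)//= eqxx big1 ?mulr1// => l /negbTE ->.
rewrite -(bigA_distr_bigA F) (bigD1 j)//= [X in _ * X]big1 ?mulr1; last first.
  move=> l /negbTE lj; rewrite /F lj; under eq_bigr do rewrite mulr1.
  exact: bern_sum1.
rewrite /F eqxx.
rewrite (eq_bigr (fun m : 'I_K.+1 => (K%:R ^-1) ^+ 2 *
   (bern (u j) K m * (m%:R - K%:R * u j) ^+ 2))); last first.
  by move=> m _; field; rewrite gt_eqF.
rewrite -mulr_sumr bern_var subrr expr0n addr0.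
have -> : K%:R^-1 ^+ 2 * (K%:R * u j * (1 - u j)) = K%:R^-1 * (u j * (1 - u j)) :> R.
  by field; rewrite gt_eqF.
rewrite ler_piMr ?invr_ge0 ?(ltW K0')//.
by have /andP[h1 h2] := u01 j; nra.
Qed.

End Bernstein.

(** * Bounded functions whose modulated integrals converge *)

Section TrigClass.
Context (R : realType) (d : nat).
Variables (mus : nat -> probability (d.-tuple R) R) (mu : probability (d.-tuple R) R).
Implicit Types (f g : d.-tuple R -> R) (xi : d.-tuple R) (a b w : R).

Let wave xi b (x : d.-tuple R) : R := cos (dotv x xi + b).

Let mwave xi b : measurable_fun setT (wave xi b).
Proof.
apply: (measurableT_comp (continuous_measurable_fun (@continuous_cos R))).
by apply: measurable_funD => //; exact: measurable_dotvl.
Qed.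

(* Modulating by arbitrary waves makes this class stable under
   multiplication by [sin (w * x_j)]. *)
Definition trig_class f := [/\ measurable_fun setT f, exists M, forall x, `|f x| <= M &
  forall xi b, \int[mus n]_x (f x * wave xi b x) @[n --> \oo] -->
               \int[mu]_x (f x * wave xi b x)].

Let int_f (P : probability (d.-tuple R) R) f xi b : measurable_fun setT f ->
  (exists M, forall x, `|f x| <= M) ->
  P.-integrable setT (EFin \o (fun x => f x * wave xi b x)).
Proof.
move=> mf [M fM]; apply: (@bounded_integrable _ _ _ _ _ M).
  exact: measurable_funM.
by move=> x; rewrite normrM -[leRHS]mulr1 ler_pM// cos_max.
Qed.

Lemma trig_class_lin f g a b : trig_class f -> trig_class g ->
  trig_class (fun x => a * f x + b * g x).
Proof.
move=> [mf bf cf] [mg bg cg]; split.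
- by apply: measurable_funD; apply: measurable_funM.
- have [M fM] := bf; have [N gN] := bg; exists (`|a| * M + `|b| * N) => x.
  by apply: le_trans (ler_normD _ _) _; rewrite !normrM lerD// ler_wpM2l.
- move=> xi c.
  have E (P : probability (d.-tuple R) R) : \int[P]_x ((a * f x + b * g x) * wave xi c x) =
      a * \int[P]_x (f x * wave xi c x) + b * \int[P]_x (g x * wave xi c x).
    have If := int_f P xi c mf bf; have Ig := int_f P xi c mg bg.
    rewrite -!RintegralZl// -RintegralD//.
    + by apply: eq_Rintegral => x _; ring.
    + exact: (integrableZl measurableT a If).
    + exact: (integrableZl measurableT b Ig).
  under eq_fun do rewrite E; rewrite E.
  by apply: cvgD; apply: cvgMr.
Qed.

Lemma eq_trig_class f g : (forall x, f x = g x) -> trig_class f -> trig_class g.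
Proof. by move=> /funext ->. Qed.

(** Product-to-sum formula: the new waves have frequencies xi + w e_j and w e_j - xi, and phases
    shifted by -pi/2 to write sines as cosines. *)
Lemma trig_class_sin f w j : trig_class f ->
  trig_class (fun x => f x * sin (w * tnth x j)).
Proof.
move=> [mf bf cf].
have msin : measurable_fun setT (fun x : d.-tuple R => sin (w * tnth x j)).
  apply: (measurableT_comp (continuous_measurable_fun (@continuous_sin R))).
  by apply: measurable_funM => //; exact: measurable_tnth.
split; first exact: measurable_funM.
  have [M fM] := bf; exists M => x.
  by rewrite normrM -[leRHS]mulr1 ler_pM// sin_max.
move=> xi b.
pose xi1 : d.-tuple R := [tuple tnth xi i + w * (i == j)%:R | i < d].
pose xi2 : d.-tuple R := [tuple w * (i == j)%:R - tnth xi i | i < d].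
have sumd (x : d.-tuple R) : \sum_(i < d) tnth x i * (w * (i == j)%:R) = w * tnth x j.
  rewrite (bigD1 j)//= eqxx mulr1 big1 ?addr0 1?mulrC// => i /negbTE ->.
  by rewrite !mulr0.
have d1 (x : d.-tuple R) : dotv x xi1 = dotv x xi + w * tnth x j.
  by rewrite -sumd /dotv -big_split/=; apply: eq_bigr => i _; rewrite tnth_mktuple mulrDr.
have d2 (x : d.-tuple R) : dotv x xi2 = w * tnth x j - dotv x xi.
  by rewrite -sumd /dotv -sumrB; apply: eq_bigr => i _; rewrite tnth_mktuple mulrBr.
have E (P : probability (d.-tuple R) R) : \int[P]_x (f x * sin (w * tnth x j) * wave xi b x) =
    2^-1 * \int[P]_x (f x * wave xi1 (b - pi / 2) x) +
    2^-1 * \int[P]_x (f x * wave xi2 (- b - pi / 2) x).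
  have I1 := int_f P xi1 (b - pi / 2) mf bf; have I2 := int_f P xi2 (- b - pi / 2) mf bf.
  rewrite -!RintegralZl// -RintegralD//.
  + apply: eq_Rintegral => x _; rewrite /wave d1 d2.
    have -> : dotv x xi + w * tnth x j + (b - pi / 2) =
      (w * tnth x j + (dotv x xi + b)) - pi / 2 by ring.
    have -> : w * tnth x j - dotv x xi + (- b - pi / 2) =
      (w * tnth x j - (dotv x xi + b)) - pi / 2 by ring.
    by rewrite !cosBpihalf sinD sinB; field.
  + exact: (integrableZl measurableT _ I1).
  + exact: (integrableZl measurableT _ I2).
under eq_fun do rewrite E; rewrite E.
by apply: cvgD; apply: cvgMr.
Qed.

(** Bounded with values in [0, 1], hence usable as a Bernoulli parameter, and injective in x_j where
    |w x_j| <= 1. *)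
Definition sincoord w (x : d.-tuple R) (j : 'I_d) : R := (1 + sin (w * tnth x j)) / 2.

Lemma sincoord01 w x j : 0 <= sincoord w x j <= 1.
Proof.
have := sin_geN1 (w * tnth x j); have := sin_le1 (w * tnth x j).
by rewrite /sincoord => h1 h2; apply/andP; split; lra.
Qed.

Lemma trig_class_sincoord f w j : trig_class f -> trig_class (fun x => f x * sincoord w x j).
Proof.
move=> tf; apply: eq_trig_class (trig_class_lin 2^-1 2^-1 tf (trig_class_sin w j tf)).
by move=> x; rewrite /sincoord; field.
Qed.

(** The induction runs over all [f]: the recursion for one more trial moves a factor u or 1 - u into
    [f]. *)
Lemma trig_class_bern f w j K m : trig_class f ->
  trig_class (fun x => f x * bern (sincoord w x j) K m).
Proof.
elim: K f m => [|K IH] f m tf /=.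
  apply: eq_trig_class (trig_class_lin (m == 0%N)%:R 0 tf tf) => x; ring.
have tu := trig_class_sincoord w j tf.
have t1 : trig_class (fun x => f x * (1 - sincoord w x j)).
  by apply: eq_trig_class (trig_class_lin 1 (- 1) tf tu) => x; ring.
case: m => [|m].
  by apply: eq_trig_class (IH _ 0%N t1) => x; ring.
by apply: eq_trig_class (trig_class_lin 1 1 (IH _ m.+1 t1) (IH _ m tu)) => x; ring.
Qed.

Lemma trig_class_cellw w K i : trig_class (fun=> 1) ->
  trig_class (fun x => @cellw R d K (sincoord w x) i).
Proof.
move=> t1; rewrite /cellw; elim: (index_enum _) => [|j s IH].
  by apply: eq_trig_class t1 => x; rewrite big_nil.
apply: eq_trig_class (trig_class_bern w j K (i j) IH) => x.
by rewrite big_cons mulrC.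
Qed.

Lemma trig_class_cvg f : trig_class f ->
  \int[mus n]_x f x @[n --> \oo] --> \int[mu]_x f x.
Proof.
move=> [_ _ /(_ [tuple 0 | i < d] 0)].
suff -> : (fun x => f x * wave [tuple 0 | i < d] 0 x) = f by [].
apply/funext => x; rewrite /wave /dotv big1 ?addr0 ?cos0 ?mulr1// => j _.
by rewrite tnth_mktuple mulr0.
Qed.

End TrigClass.

(** * Sliced convergence implies convergence *)

Section SlicedToFull.
Context (R : realType) (d : nat) (p : R) (d0 : (0 < d)%N) (p1 : 1 <= p).

Let p_gt0 : 0 < p. Proof. exact: lt_le_trans p1. Qed.
Let p_ge0 : 0 <= p. Proof. exact: ltW. Qed.

(** Inside the ball the arguments of sine stay in [-1, 1], so [sin_expand] applies coordinatewise; L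
    undoes the scaling and 2 the halving in [sincoord]. *)
Lemma sincoord_expand (L : R) (x y : d.-tuple R) : 0 < L ->
  normv x <= L -> normv y <= L ->
  distv x y ^+ 2 <= (2 * L / cos 1) ^+ 2 *
    \sum_j (sincoord L^-1 x j - sincoord L^-1 y j) ^+ 2.
Proof.
move=> L0 xL yL; rewrite sqr_sqrtr; last by apply: sumr_ge0 => i _; rewrite sqr_ge0.
rewrite mulr_sumr; apply: ler_sum => j _.
have c1 := @cos1_gt0 R.
have small (z : d.-tuple R) : normv z <= L -> `|L^-1 * tnth z j| <= 1.
  move=> zL; rewrite normrM ger0_norm ?invr_ge0 ?(ltW L0)//.
  by rewrite mulrC ler_pdivrMr// mul1r (le_trans (normv_coord z j)).
have h := sin_expand (small _ xL) (small _ yL).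
rewrite -exprMn -[leLHS]real_normK ?num_real// -[leRHS]real_normK ?num_real//.
rewrite ler_sqr ?nnegrE// /sincoord.
have -> : (1 + sin (L^-1 * tnth x j)) / 2 - (1 + sin (L^-1 * tnth y j)) / 2 =
  (sin (L^-1 * tnth x j) - sin (L^-1 * tnth y j)) / 2 by field.
have k0 : 0 <= 2 * L / cos 1 by rewrite divr_ge0 ?mulr_ge0// ltW.
rewrite normrM (ger0_norm k0) normrM (@ger0_norm _ 2^-1)//.
have -> : 2 * L / cos 1 * (`|sin (L^-1 * tnth x j) - sin (L^-1 * tnth y j)| / 2) =
  L / cos 1 * `|sin (L^-1 * tnth x j) - sin (L^-1 * tnth y j)|.
  by field; rewrite gt_eqF.
have -> : `|tnth x j - tnth y j| =
    L / cos 1 * (cos 1 * `|L^-1 * tnth x j - L^-1 * tnth y j|).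
  rewrite -mulrBr normrM ger0_norm ?invr_ge0 ?(ltW L0)//; field.
  by rewrite !gt_eqF.
by rewrite ler_wpM2l// divr_ge0// ltW.
Qed.

Lemma measurable_sincoord w j : measurable_fun setT (fun x : d.-tuple R => sincoord w x j).
Proof.
apply: measurable_funM => //; apply: measurable_funD => //.
apply: (measurableT_comp (continuous_measurable_fun (@continuous_sin R))).
by apply: measurable_funM => //; exact: measurable_tnth.
Qed.

Lemma measurable_bern w j K m :
  measurable_fun setT (fun x : d.-tuple R => bern (sincoord w x j) K m).
Proof.
elim: K m => [|K IH] m /=; first exact: measurable_cst.
have mc := measurable_sincoord w j.
apply: measurable_funD; apply: measurable_funM => //; first exact: measurable_funB.
by case: m => [|m]; [exact: measurable_cst|exact: IH].
Qed.

Lemma measurable_cellw w K (i : {ffun 'I_d -> 'I_K.+1}) :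
  measurable_fun setT (fun x : d.-tuple R => cellw (sincoord w x) i).
Proof.
rewrite /cellw; elim: (index_enum _) => [|j s IH].
  by under eq_fun do rewrite big_nil; exact: measurable_cst.
under eq_fun do rewrite big_cons.
by apply: measurable_funM => //; exact: measurable_bern.
Qed.

Lemma distv_pow_tails (L : R) (x y : d.-tuple R) : 0 <= L ->
  L < normv x \/ L < normv y ->
  distv x y `^ p <= 2 `^ p * tailpow p L (normv x) + 2 `^ p * tailpow p L (normv y).
Proof.
move=> L0; wlog xy : x y / normv y <= normv x.
  move=> W; have [xy|/ltW yx] := leP (normv y) (normv x); first exact: W.
  by move=> /or_comm h; rewrite distvC addrC; exact: W.
move=> h; have Lx : L < normv x by case: h => // /lt_le_trans; apply.
rewrite (tailpow_gt _ Lx); apply: (@le_trans _ _ (2 `^ p * normv x `^ p)).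
  apply: powR_le_scale; rewrite ?distv_ge0 ?normv_ge0//.
  by apply: le_trans (distv_le x y) _; lra.
by rewrite lerDl mulr_ge0 ?powR_ge0// tailpow_ge0.
Qed.

Variables (mus : nat -> probability (d.-tuple R) R) (mu : probability (d.-tuple R) R).
Hypotheses (Hsw : converges_under (SW p) mus mu) (pmu : finite_moment p mu).

Let trig1 : trig_class mus mu (fun=> 1).
Proof.
split; first exact: measurable_cst.
  by exists 1 => x; rewrite normr1.
move=> xi b.
suff -> : (fun x : d.-tuple R => 1 * cos (dotv x xi + b)) =
  (fun x => cos (dotv x xi + b)) by exact: cos_integral_cvg pmu _ _.
by apply/funext => x; rewrite mul1r.
Qed.

Lemma Wp_eventually_le (e : R) : 0 < e ->
  \forall n \near \oo, (Wp p (mus n) mu `^ p <= e%:E)%E.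
Proof.
(* Budget: 3 E for the two integrals of [tau], E for [B *+ 2] and 2 E for the leftover mass. *)
move=> e0; pose E := e / 8.
have E0 : 0 < E by rewrite divr_gt0.
have eE : e = 8 * E by rewrite /E; field.
clearbody E.
have tp0 : 0 < 2 `^ p :> R by rewrite powR_gt0.
have [L [L1 tmu tn]] := tail_uniform d0 p1 Hsw pmu (divr_gt0 E0 tp0).
have L0 : 0 < L by exact: lt_le_trans L1.
pose D : R := (2 * L) `^ p.
have D0 : 0 < D by rewrite powR_gt0// mulr_gt0.
pose del : R := E `^ p^-1.
have del0 : 0 < del by rewrite powR_gt0.
have delp : del `^ p = E by rewrite /del -powRrM mulVf ?gt_eqF// powRr1// ltW.
clearbody del.
(* For points of the ball more than [del] apart, the cost is at most D <= D (|x - y| / del)^2.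
   [sincoord_expand] turns this into squared differences of sine coordinates, and (a - b)^2 <= 2 (a
   - m)^2 + 2 (b - m)^2 supplies the leading 2. *)
pose A : R := 2 * (2 * L / cos 1) ^+ 2 * D / del ^+ 2.
have c1 := @cos1_gt0 R.
have A0 : 0 < A by rewrite !mulr_gt0 ?invr_gt0 ?exprn_gt0// !mulr_gt0 ?invr_gt0.
(* The mean squared deviation within cells is at most d / K, and [K] is large enough for 2 A d / K
   <= E. *)
pose K := (Num.trunc (2 * A * d%:R / E)).+1.
pose B : R := A * (d%:R / K%:R).
have B2 : B *+ 2 <= E.
  have h : 2 * A * d%:R / E < K%:R by exact: truncnS_gt.
  have K0 : 0 < K%:R :> R by rewrite ltr0n.
  rewrite /B mulr2n; have -> : A * (d%:R / K%:R) + A * (d%:R / K%:R) =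
    (2 * A * d%:R) / K%:R by field; rewrite gt_eqF.
  by rewrite ler_pdivrMr// [E * _]mulrC -ler_pdivrMr// ltW.
(* [gam] serves twice: as the [dl] of the coupling and as the total tolerated change of cell masses,
   [gam / N] per cell. *)
pose gam := Num.min 1 (E / D).
have gam0 : 0 < gam by rewrite lt_min ltr01 divr_gt0.
have gam1 : gam <= 1 by rewrite ge_min lexx.
have gamD : D * gam <= E.
  by rewrite mulrC -ler_pdivlMr// ge_min lexx orbT.
clearbody gam.
pose I := {ffun 'I_d -> 'I_K.+1}.
pose g (i : I) (x : d.-tuple R) := cellw (sincoord L^-1 x) i.
have mg i : measurable_fun setT (g i) by exact: measurable_cellw.
have g0 i x : 0 <= g i x by apply: cellw_ge0 => j; exact: sincoord01.
have g1 x : \sum_i g i x = 1 by exact: cellw_sum1.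
pose N : R := #|{: I}|%:R.
have N0 : 0 < N by rewrite ltr0n card_ffun !card_ord expn_gt0.
have gN0 : 0 < gam / N by rewrite divr_gt0.
(* The two constants E / 2 together absorb pairs at distance at most [del], whose cost is at most
   del^p = E. *)
pose tau (x : d.-tuple R) := 2 `^ p * tailpow p L (normv x) + E / 2.
have mtail : measurable_fun setT (fun x : d.-tuple R => tailpow p L (normv x)).
  by apply: measurable_tailpow; exact: measurable_normv.
have mtau : measurable_fun setT tau.
  by apply: measurable_funD => //; exact: measurable_funM.
have tau0 x : 0 <= tau x.
  apply: addr_ge0; first by apply: mulr_ge0; [exact: ltW|exact: tailpow_ge0].
  by apply: divr_ge0 => //; exact: ltW.
pose V (i : I) (x : d.-tuple R) := A * \sum_j (sincoord L^-1 x j - (i j)%:R / K%:R) ^+ 2.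
have mV i : measurable_fun setT (V i).
  apply: measurable_funM => //; apply: measurable_sum => j; apply: measurable_funX.
  by apply: measurable_funB => //; exact: measurable_sincoord.
have V0 i x : 0 <= V i x.
  by apply: mulr_ge0; [exact: ltW|apply: sumr_ge0 => j _; rewrite sqr_ge0].
have gVB x : \sum_i g i x * V i x <= B.
  rewrite (eq_bigr (fun i => A * (g i x * \sum_j (sincoord L^-1 x j - (i j)%:R / K%:R) ^+ 2))).
    rewrite -mulr_sumr /B ler_pM2l//; apply: cellw_var => // j; exact: sincoord01.
  by move=> i _; rewrite /V mulrCA.
have nearD (x y : d.-tuple R) : normv x <= L -> normv y <= L -> distv x y `^ p <= D.
  move=> xL yL; have h : distv x y <= 2 * L by apply: le_trans (distv_le x y) _; lra.
  by apply: ge0_ler_powR; rewrite ?nnegrE ?distv_ge0 ?mulr_ge0 ?(ltW L0).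
have tE x y : 2 `^ p * tailpow p L (normv x) + 2 `^ p * tailpow p L (normv y) <=
    tau x + tau y by rewrite /tau; lra.
have tE' x y : E <= tau x + tau y.
  have hx : 0 <= 2 `^ p * tailpow p L (normv x) by rewrite mulr_ge0 ?tailpow_ge0// ltW.
  have hy : 0 <= 2 `^ p * tailpow p L (normv y) by rewrite mulr_ge0 ?tailpow_ge0// ltW.
  rewrite /tau; lra.
have far x y : L < normv x \/ L < normv y -> distv x y `^ p <= tau x + tau y.
  by move=> h; apply: le_trans (tE x y); apply: distv_pow_tails => //; exact: ltW.
have close (x y : d.-tuple R) : (L < normv x \/ L < normv y) \/ (normv x <= L /\ normv y <= L).
  have [?|?] := ltP L (normv x); first by left; left.
  by have [?|?] := ltP L (normv y); [left; right|right].
have cD x y : distv x y `^ p <= tau x + tau y + D.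
  have [h|[xL yL]] := close x y; first by apply: le_trans (far _ _ h) _; rewrite lerDl ltW.
  by apply: ler_wpDl; [exact: addr_ge0|exact: nearD].
have cV i x y : distv x y `^ p <= tau x + tau y + V i x + V i y.
  have [h|[xL yL]] := close x y.
    apply: le_trans (far _ _ h) _; rewrite -(addrA (tau x + tau y)) lerDl.
    exact: addr_ge0.
  have [h|h] := leP (distv x y) del.
    rewrite -(addrA (tau x + tau y)); apply: ler_wpDr; first exact: addr_ge0.
    apply: le_trans (tE' x y); rewrite -delp.
    by rewrite ge0_ler_powR ?nnegrE ?distv_ge0// ltW.
  rewrite -(addrA (tau x + tau y)); apply: ler_wpDl; first exact: addr_ge0.
  apply: (@le_trans _ _ (D * (distv x y ^+ 2 / del ^+ 2))).
    apply: (@le_trans _ _ D).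
      exact: nearD.
    rewrite ler_peMr ?(ltW D0)// ler_pdivlMr ?exprn_gt0// mul1r.
    by rewrite ler_sqr ?nnegrE ?distv_ge0 ?ltW// (lt_trans del0).
  rewrite /V -mulrDr -big_split/=.
  apply: (@le_trans _ _ (D / del ^+ 2 * ((2 * L / cos 1) ^+ 2 *
      \sum_j (sincoord L^-1 x j - sincoord L^-1 y j) ^+ 2))).
    rewrite [X in X <= _](_ : _ = D / del ^+ 2 * distv x y ^+ 2); last by ring.
    rewrite ler_wpM2l ?divr_ge0 ?sqr_ge0 ?(ltW D0)//.
    exact: sincoord_expand.
  have -> : A = D / del ^+ 2 * (2 * L / cos 1) ^+ 2 * 2 by rewrite /A; ring.
  rewrite mulrA -(mulrA (D / del ^+ 2 * (2 * L / cos 1) ^+ 2) 2).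
  apply: ler_wpM2l; first by rewrite mulr_ge0 ?sqr_ge0// divr_ge0 ?sqr_ge0// ltW.
  rewrite mulr_sumr; apply: ler_sum => j _.
  set a := sincoord L^-1 x j; set b := sincoord L^-1 y j; set m := _ / _.
  have : 0 <= ((a - m) + (b - m)) ^+ 2 by exact: sqr_ge0.
  nra.
have cvg_g (i : I) : \int[mus n]_x g i x @[n --> \oo] --> \int[mu]_x g i x.
  by apply: trig_class_cvg; exact: trig_class_cellw.
near=> n.
have tnn : (tail p (mus n) L <= (E / 2 `^ p)%:E)%E by near: n.
have gn (i : I) : `|\int[mu]_x g i x - \int[mus n]_x g i x| <= gam / N.
  move: i; near: n; apply: filter_forall => i.
  by move/cvgrPdist_le: (cvg_g i); apply.
have [pi [cpl cost]] := partition_coupling (mus n) mu mg g0 g1 gam0 gam1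
  mtau tau0 mV V0 gVB (ltW D0) (fun z => powR_ge0 (distv z.1 z.2) p) cD cV.
apply: le_trans (le_Wasserstein p1 (@distv R d) cpl) _.
apply: le_trans cost _.
have Itau (P : probability (d.-tuple R) R) : (tail p P L <= (E / 2 `^ p)%:E)%E ->
    (\int[P]_x (tau x)%:E <= (E + E / 2)%:E)%E.
  move=> tP; under eq_integral do rewrite EFinD EFinM.
  rewrite ge0_integralD; last 5 first.
  - exact: measurableT.
  - by move=> x _; rewrite -EFinM lee_fin mulr_ge0 ?tailpow_ge0// ltW.
  - by apply: measurable_funeM; exact/measurable_EFinP.
  - by move=> x _; rewrite lee_fin divr_ge0// ltW.
  - exact: measurable_cst.
  rewrite integral_cst// [X in (_ + _ * X)%E](_ : _ = 1%E) ?mule1; last exact: probability_setT.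
  rewrite EFinD leeD2r// ge0_integralZl_EFin; last 4 first.
  - exact: measurableT.
  - by move=> x _; rewrite lee_fin tailpow_ge0.
  - exact/measurable_EFinP.
  - exact: ltW.
  have -> : E%:E = ((2 `^ p)%:E * (E / 2 `^ p)%:E)%E :> \bar R.
    by rewrite -EFinM; congr (_%:E); field; rewrite gt_eqF.
  by rewrite lee_wpmul2l// lee_fin ltW.
apply: (le_trans (leeD2r _ (leeD (Itau _ tnn) (Itau _ tmu)))).
rewrite -!EFinD lee_fin.
have summin : 1 - gam <=
    \sum_i Num.min (\int[mus n]_x g i x) (\int[mu]_x g i x).
  have -> : 1 - gam = \sum_i (\int[mu]_x g i x - gam / N).
    rewrite sumrB (partition_sum_integral mg g0 g1) sumr_const -[_ *+ _]mulr_natl.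
    by rewrite -/N; field; rewrite gt_eqF.
  apply: ler_sum => i _; have := gn i; rewrite ler_norml => /andP[h1 h2].
  by rewrite le_min; apply/andP; split; [lra|rewrite gerBl ltW].
(* The leftover mass is at most 1 - (1 - gam)^2 <= 2 gam. *)
have : D * (1 - (1 - gam) * \sum_i Num.min (\int[mus n]_x g i x) (\int[mu]_x g i x))
    <= D * (gam + gam).
  rewrite ler_pM2l//.
  have : (1 - gam) * (1 - gam) <= (1 - gam) *
    \sum_i Num.min (\int[mus n]_x g i x) (\int[mu]_x g i x).
    by rewrite ler_wpM2l// subr_ge0.
  have : 0 <= gam * gam by rewrite mulr_ge0// ltW.
  lra.
rewrite mulrDr; lra.
Unshelve. all: by end_near. Qed.

Lemma SW_to_Wp : converges_under (Wp p) mus mu.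
Proof.
apply/cvge0P => [n|e e0]; first exact: poweR_ge0.
have := Wp_eventually_le (powR_gt0 p e0).
apply: filterS => n h; apply: (poweR_le p1); rewrite ?lee_fin ?(ltW e0)//.
exact: poweR_ge0.
Qed.

End SlicedToFull.

(** * Assembling the inequalities and the equivalence *)

Lemma cvge0_le (R : realType) (u v : nat -> \bar R) (a : R) : 0 < a ->
  (forall n, (0 <= u n)%E) -> (forall n, (a%:E * u n <= v n)%E) ->
  v @ \oo --> (0 : \bar R) -> u @ \oo --> (0 : \bar R).
Proof.
move=> a0 u0 uv; have v0 n : (0 <= v n)%E.
  by apply: le_trans (uv n); rewrite mule_ge0// lee_fin ltW.
move=> /(cvge0P v0) H; apply/(cvge0P u0) => e e0.
apply: filterS (H _ (mulr_gt0 a0 e0)) => n h.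
by rewrite -(@lee_pmul2l _ a%:E)// -EFinM; exact: le_trans h.
Qed.

Unset Implicit Arguments.

Theorem theorem2 (R : realType) (d : nat) (p C : R) :
  (2 <= d)%N -> 1 <= p -> admissible d C ->
  (forall mu nu : probability (d.-tuple R) R,
     finite_moment p mu -> finite_moment p nu ->
     (* (a) *)
     (DSW p mu nu C <= maxSW p mu nu <= Wp p mu nu)%E /\
     (* (b) *)
     (d%:R^-1 <= C ->
        (((d%:R^-1) `^ p^-1)%:E * maxSW p mu nu <= DSW p mu nu C)%E /\
        (((d%:R^-1) `^ p^-1)%:E * SW p mu nu <=
           ((d%:R^-1) `^ p^-1)%:E * maxSW p mu nu)%E)) /\
  (* consequence: topological equivalence when C >= 1/d *)
  (d%:R^-1 <= C ->
   forall (mus : nat -> probability (d.-tuple R) R) (mu : probability (d.-tuple R) R),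
     (forall n, finite_moment p (mus n)) -> finite_moment p mu ->
     (converges_under (Wp p) mus mu <-> converges_under (SW p) mus mu) /\
     (converges_under (Wp p) mus mu <-> converges_under (maxSW p) mus mu) /\
     (converges_under (Wp p) mus mu <->
        converges_under (fun a b => DSW p a b C) mus mu)).
Proof.
move=> d2 p1 _; have d0 : (0 < d)%N by exact: leq_trans d2.
split=> [mu nu _ _|dC mus mu _ pmu].
  split; first by rewrite DSW_le_maxSW// maxSW_le_Wp.
  move=> dC; split; first exact: DSW_ge_maxSW.
  by rewrite lee_wpmul2l ?lee_fin ?powR_ge0// SW_le_maxSW.
have a0 : 0 < (d%:R^-1 : R) `^ p^-1 by rewrite powR_gt0// invr_gt0 ltr0n.
have M0 n : (0 <= maxSW p (mus n) mu)%E by exact: maxSW_ge0.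
have S0 n : (0 <= SW p (mus n) mu)%E by exact: poweR_ge0.
(* Nonnegativity of the supremum is read off the lower bound (b). *)
have DSW0 n : (0 <= DSW p (mus n) mu C)%E.
  by apply: le_trans (DSW_ge_maxSW p1 d0 _ _ dC); rewrite mule_ge0// lee_fin ltW.
have WM : converges_under (Wp p) mus mu -> converges_under (maxSW p) mus mu.
  by apply: cvge0_le ltr01 M0 _ => n; rewrite mul1e maxSW_le_Wp.
have MD : converges_under (maxSW p) mus mu ->
    converges_under (fun a b => DSW p a b C) mus mu.
  by apply: cvge0_le ltr01 DSW0 _ => n; rewrite mul1e DSW_le_maxSW.
have DM : converges_under (fun a b => DSW p a b C) mus mu ->
    converges_under (maxSW p) mus mu.
  by apply: cvge0_le a0 M0 _ => n; exact: DSW_ge_maxSW.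
have MS : converges_under (maxSW p) mus mu -> converges_under (SW p) mus mu.
  by apply: cvge0_le ltr01 S0 _ => n; rewrite mul1e SW_le_maxSW.
have SWp : converges_under (SW p) mus mu -> converges_under (Wp p) mus mu.
  by move=> H; exact: SW_to_Wp.
split; first by split=> [/WM/MS|/SWp].
split; first by split=> [/WM|/MS/SWp].
by split=> [/WM/MD|/DM/MS/SWp].
Qed.
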